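(* To every plane configuration theorem with initial data consisting of points $a_i$, lines $b_j$, and incidences between them, there corresponds a configuration theorem for lines in 3-dimensional space (elliptic, Euclidean, or hyperbolic), so that: (i) to each point $a_i$ and each line $b_j$ of the initial data there corresponds a line in space; (ii) whenever a point $a_i$ and a line $b_j$ are incident, the respective lines in space intersect at right angle; (iii) the operations of connecting two points by a line and of intersecting two lines at a point are replaced by the operation of taking the skewer of two lines. If, in addition, the plane configuration theorem involves a polarity, then each pair of polar dual points and lines involved corresponds to the same line in space, and the operation of taking the polar dual object in the plane (point $\leftrightarrow$ line) corresponds to the trivial operation of leaving a line in space intact. In other words: if the plane configuration theorem holds, then the configuration theorem for lines in space obtained from it by this dictionary (applied to its initial data, its list of instructions and its conclusion) holds as well.
   Context: Plane configuration theorem. The initial data is a collection of labelled points $a_i$ and lines $b_j$ in $\mathbb{RP}^2$ such that, for some prescribed pairs of indices $(i,j)$, the point $a_i$ lies on the line $b_j$. One also has an ordered list of instructions, each being one of two operations: draw the line through a certain pair of (already labelled) points, or intersect a certain pair of (already labelled) lines at a point; the new lines and points also receive labels. The statement of the theorem is that, among the so constructed points and lines, certain incidence relations hold, i.e. certain points lie on certain lines. The conclusion is required to hold for almost every initial configuration satisfying the initial conditions, that is, for a Zariski open set of such initial configurations. Polarity. A polarity is a projective isomorphism $\varphi:\mathbb{RP}^2\to(\mathbb{RP}^2)^*$ induced by a self-adjoint linear isomorphism $V\to V^*$, where $\mathbb{RP}^2$ is the projectivization of the 3-dimensional vector space $V$; it assigns to each point its polar line and to each line its polar point. A plane configuration theorem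 involving a polarity may also prescribe in its initial data that, for some pairs $(k,l)$, the point $a_k$ is polar dual to the line $b_l$; it may use the operation of taking the polar dual object (point $\leftrightarrow$ line) in its list of instructions; and it may assert in its conclusion that certain points are polar dual to certain lines. Configuration theorem for lines in space. The initial data is a collection of labelled lines $\ell_i$ such that, for some prescribed pairs $(i,j)$, the lines $\ell_i$ and $\ell_j$ intersect at right angle. There is only one operation, taking the skewer of two lines. The statement is that certain pairs of the thus constructed lines intersect at right angle. The conclusion holds for almost all initial configurations of lines (a Zariski open set) satisfying the initial conditions. Skewer. A skewer of two lines is a line intersecting both of them at right angle. It is assumed that the data is in general position, so that each skewer to be drawn is well defined and unique. Elliptic space is $\mathbb{RP}^3$ with its metric of constant positive curvature; there a generic pair of lines has exactly two skewers, which are dual to each other (the dual of the line given by a 2-plane in $\mathbb{R}^4$ is the line given by the orthogonal 2-plane). In the elliptic case either choice of skewer is allowed (equivalently, a line and its dual are identified).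
   Formalization: For Euclidean and hyperbolic space the Zariski open set of plane initial configurations must contain a nonsingular one (each solution of the linearized initial conditions is a velocity of real ones); ''almost every'' means a nonempty Zariski open set; a polarity theorem is for all polarities. *)

(* Defs.v *)
From mathcomp Require Import all_boot all_order all_algebra.
From mathcomp Require Import all_classical all_reals all_analysis.
(* Not imported: its notations clash with those of MathComp-Analysis. *)
From mathcomp Require multinomials.mpoly.

Set Implicit Arguments.
Unset Strict Implicit.
Unset Printing Implicit Defensive.

Import Order.TTheory GRing.Theory Num.Theory.
Import numFieldNormedType.Exports.

Local Open Scope ring_scope.
Local Open Scope classical_set_scope.

(* The points are labelled 0, 1, 2, ... and so are, independently, the lines.
   The initial objects come first; every instruction creates one object, which
   receives the next free label of its sort. *)
Inductive instruction : Type :=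
  | Connect of nat & nat
  | Intersect of nat & nat
  | PolarLine of nat
  | PolarPoint of nat.

Record configuration := Configuration {
  npoints : nat;
  nlines : nat;
  init_incident : seq ('I_npoints * 'I_nlines);
  init_polar : seq ('I_npoints * 'I_nlines);
  instructions : seq instruction;
  concl_incident : seq (nat * nat);
  concl_polar : seq (nat * nat)
}.

(* [p] and [l] count the points and lines labelled so far. *)
Fixpoint labels_ok (s : seq instruction) (p l : nat)
    (concl : seq (nat * nat)) : bool :=
  match s with
  | [::] => all (fun c => (c.1 < p)%N && (c.2 < l)%N) concl
  | Connect i j :: s' => [&& (i < p)%N, (j < p)%N & labels_ok s' p l.+1 concl]
  | Intersect i j :: s' => [&& (i < l)%N, (j < l)%N & labels_ok s' p.+1 l concl]
  | PolarLine i :: s' => (i < p)%N && labels_ok s' p l.+1 concl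
  | PolarPoint j :: s' => (j < l)%N && labels_ok s' p.+1 l concl
  end.

(* Every label that is used refers to an object which already exists. *)
Definition well_labelled (T : configuration) : bool :=
  labels_ok (instructions T) (npoints T) (nlines T)
    (concl_incident T ++ concl_polar T).

(* A world in which configurations can be interpreted. Points and lines are
   given by (homogeneous) coordinates, arranged in a matrix; [same_point] and
   [same_line] tell when two coordinate matrices denote the same object. *)
Record world (R : realType) := World {
  nrows : nat;
  ncols : nat;
  is_point : 'M[R]_(nrows, ncols) -> Prop;
  is_line : 'M[R]_(nrows, ncols) -> Prop;
  same_point : 'M[R]_(nrows, ncols) -> 'M[R]_(nrows, ncols) -> Prop;
  same_line : 'M[R]_(nrows, ncols) -> 'M[R]_(nrows, ncols) -> Prop;
  incident : 'M[R]_(nrows, ncols) -> 'M[R]_(nrows, ncols) -> Prop;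
  polar : 'M[R]_(nrows, ncols) -> 'M[R]_(nrows, ncols) -> Prop
}.

Section Interpretation.
Variables (R : realType) (W : world R).
Notation coords := 'M[R]_(nrows W, ncols W).

(* The operation whose possible results form the set [A] is well defined
   (there is a result, unique up to [same]), and [K] holds for the result,
   whichever coordinates represent it. *)
Definition for_the (same : coords -> coords -> Prop) (A : set coords)
    (K : coords -> Prop) : Prop :=
  [/\ A !=set0, (forall z z', A z -> A z' -> same z z')
    & forall z, A z -> K z].

Definition connecting (p p' : coords) : set coords :=
  [set l | [/\ is_line l, incident p l & incident p' l]].
Definition intersecting (l l' : coords) : set coords :=
  [set p | [/\ is_point p, incident p l & incident p l']].
Definition polar_line_of (p : coords) : set coords :=
  [set l | is_line l /\ polar p l].
Definition polar_point_of (l : coords) : set coords :=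
  [set p | is_point p /\ polar p l].

(* All the instructions of [s] can be carried out, starting from the points
   [P] and the lines [L], and the resulting points and lines satisfy [K]. *)
Fixpoint after (s : seq instruction) (K : seq coords -> seq coords -> Prop)
    (P L : seq coords) : Prop :=
  match s with
  | [::] => K P L
  | Connect i j :: s' =>
      for_the (@same_line R W) (connecting P`_i P`_j)
        (fun l => after s' K P (rcons L l))
  | Intersect i j :: s' =>
      for_the (@same_point R W) (intersecting L`_i L`_j)
        (fun p => after s' K (rcons P p) L)
  | PolarLine i :: s' =>
      for_the (@same_line R W) (polar_line_of P`_i)
        (fun l => after s' K P (rcons L l))
  | PolarPoint j :: s' =>
      for_the (@same_point R W) (polar_point_of L`_j)
        (fun p => after s' K (rcons P p) L)
  end.

Variable T : configuration.

Definition object : Type := ('I_(npoints T) + 'I_(nlines T))%type.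

Definition initial_conditions (x : object -> coords) : Prop :=
  [/\ (forall i, is_point (x (inl i))),
      (forall j, is_line (x (inr j))),
      (forall c, c \in init_incident T -> incident (x (inl c.1)) (x (inr c.2)))
    & (forall c, c \in init_polar T -> polar (x (inl c.1)) (x (inr c.2)))].

Definition conclusion (P L : seq coords) : Prop :=
  (forall c, c \in concl_incident T -> incident P`_(c.1) L`_(c.2)) /\
  (forall c, c \in concl_polar T -> polar P`_(c.1) L`_(c.2)).

Definition conclusion_holds (x : object -> coords) : Prop :=
  after (instructions T) conclusion
    [seq x (inl i) | i <- enum 'I_(npoints T)]
    [seq x (inr j) | j <- enum 'I_(nlines T)].

Definition coordinate : finType :=
  (('I_(npoints T) + 'I_(nlines T)) * ('I_(nrows W) * 'I_(ncols W)))%type.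

(* The complement of the common zeros of a set [S] of polynomials in all the
   coordinates of all the initial objects. The polynomials need not be
   homogeneous: passing to the quotient by the changes of coordinates which
   represent the same objects is an open map for the Zariski topologies. *)
Definition zariski_open (U : set (object -> coords)) : Prop :=
  exists S : set (mpoly.mpoly #|coordinate| R),
    U = [set x | exists2 g, S g &
      mpoly.meval (fun k => let c := enum_val k in x c.1 c.2.1 c.2.2) g != 0].

(* The theorem holds on the trace, on the set of initial configurations, of
   a Zariski open set; this trace has to contain some [regular] point. *)
Definition holds_generically (regular : set (object -> coords)) : Prop :=
  exists U : set (object -> coords),
    [/\ zariski_open U,
        (exists x, [/\ initial_conditions x, U x & regular x])
      & forall x, initial_conditions x -> U x -> conclusion_holds x].

End Interpretation.

Section Plane.
Variable R : realType.

(* The matrix, in dual bases, of a self-adjoint isomorphism V -> V^*. *)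
Definition is_polarity (phi : 'M[R]_3) : Prop :=
  phi^T = phi /\ phi \in unitmx.

Definition proportional (a b : 'rV[R]_3) : Prop :=
  exists2 c : R, c != 0 & b = c *: a.

(* RP^2: a point is a nonzero vector of V = R^3, a line is a nonzero covector,
   both up to a nonzero factor. *)
Definition plane (phi : 'M[R]_3) : world R :=
  @World R 1 3
    (fun a => a != 0)
    (fun b => b != 0)
    proportional
    proportional
    (fun a b => a *m b^T = 0)
    (fun a b => proportional (a *m phi) b).

Variables (phi : 'M[R]_3) (T : configuration).

(* [v] is a tangent vector at [x] to the scheme of initial configurations: it
   satisfies the initial conditions (a . b = 0 and b = c a phi), linearized
   at [x]. *)
Definition infinitesimal_deformation (x v : object T -> 'rV[R]_3) : Prop :=
  (forall c, c \in init_incident T ->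
     v (inl c.1) *m (x (inr c.2))^T + x (inl c.1) *m (v (inr c.2))^T = 0) /\
  (forall c, c \in init_polar T -> exists s s' : R,
     x (inr c.2) = s *: (x (inl c.1) *m phi) /\
     v (inr c.2) = s' *: (x (inl c.1) *m phi) + s *: (v (inl c.1) *m phi)).

(* The initial configuration [x] is nonsingular: every infinitesimal
   deformation is the velocity of an actual deformation [y]. (The tangent cone
   of the real variety of initial configurations is the whole Zariski tangent
   space of the scheme.) *)
Definition nonsingular (x : object T -> 'rV[R]_3) : Prop :=
  forall v, infinitesimal_deformation x v ->
  exists y : R -> object T -> 'rV[R]_3,
    [/\ y 0 = x,
        (forall o k, is_derive (0 : R) (1 : R) (fun t => y t o 0 k) (v o 0 k))
      & \forall t \near (0 : R), initial_conditions (W := plane phi) (y t)].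

End Plane.

(* A theorem which involves a polarity is about an arbitrary polarity; one
   which involves none does not depend on phi. With [regular phi x := True],
   the Zariski open set is only required to be nonempty. *)
Definition plane_configuration_theorem (R : realType) (T : configuration)
    (regular : 'M[R]_3 -> set (object T -> 'rV[R]_3)) : Prop :=
  forall phi : 'M[R]_3, is_polarity phi ->
  holds_generically (W := plane phi) (T := T) (regular phi).

Inductive geometry := Elliptic | Euclidean | Hyperbolic.

Section Space.
Variable R : realType.

(* Euclidean lines: row 0 is a point of the line, row 1 is a direction. *)
Definition on_euclidean_line (L : 'M[R]_(2, 3)) (p : 'rV[R]_3) : Prop :=
  exists t : R, p = row 0 L + t *: row 1 L.

Definition euclidean_right_angle (L M : 'M[R]_(2, 3)) : Prop :=
  (exists p, on_euclidean_line L p /\ on_euclidean_line M p) /\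
  row 1 L *m (row 1 M)^T = 0.

(* Elliptic space is the projectivization of R^4 with the form
   x0^2 + x1^2 + x2^2 + x3^2; hyperbolic space is the set of the negative lines
   of R^4 with the form x0^2 + x1^2 + x2^2 - x3^2. In both cases a line is the
   set of the points contained in a 2-plane of R^4, which is the row space of
   a 2 x 4 matrix. *)
Definition form (e : R) (p q : 'rV[R]_4) : R :=
  (\sum_(k < 4 | k != ord_max) p 0 k * q 0 k) + e * (p 0 ord_max * q 0 ord_max).

Definition elliptic_point (p : 'rV[R]_4) : Prop := p != 0.
Definition hyperbolic_point (p : 'rV[R]_4) : Prop := form (-1) p p < 0.

Definition two_plane_line (point : 'rV[R]_4 -> Prop) (L : 'M[R]_(2, 4)) : Prop :=
  row_free L /\ exists2 p, point p & (p <= L)%MS.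

(* The tangent space at the point p is the orthogonal complement of p; [u] and
   [v] are the directions at the common point [p] of the two lines. *)
Definition two_plane_right_angle (e : R) (point : 'rV[R]_4 -> Prop)
    (L M : 'M[R]_(2, 4)) : Prop :=
  exists p u v : 'rV[R]_4,
    [/\ point p,
        form e p u = 0 /\ form e p v = 0,
        (L :=: col_mx p u)%MS,
        (M :=: col_mx p v)%MS
      & form e u v = 0].

Definition same_two_plane (L M : 'M[R]_(2, 4)) : Prop := (L :=: M)%MS.

(* In elliptic space a line is identified with its dual, the orthogonal
   2-plane. *)
Definition same_or_dual (L M : 'M[R]_(2, 4)) : Prop :=
  (L :=: M)%MS \/ L *m M^T = 0.

(* Points and lines of the plane both become lines in space, incidence becomes
   intersection at right angle and polar duality becomes equality. Hence the
   line connecting two points, and the point on two lines, both become a line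
   which intersects two given ones at right angle, i.e. their skewer. *)
Definition line_world r c (line : 'M[R]_(r, c) -> Prop)
    (same right_angle : 'M[R]_(r, c) -> 'M[R]_(r, c) -> Prop) : world R :=
  World line line same same right_angle same.

Definition space (g : geometry) : world R :=
  match g with
  | Elliptic =>
      line_world (two_plane_line elliptic_point) same_or_dual
        (two_plane_right_angle 1 elliptic_point)
  | Euclidean =>
      line_world (fun L : 'M[R]_(2, 3) => row 1 L != 0)
        (fun L M => forall p, on_euclidean_line L p <-> on_euclidean_line M p)
        euclidean_right_angle
  | Hyperbolic =>
      line_world (two_plane_line hyperbolic_point) same_two_plane
        (two_plane_right_angle (-1) hyperbolic_point)
  end.

End Space.

Definition space_configuration_theorem (R : realType) (g : geometry)
    (T : configuration) :=
  holds_generically (W := space R g) (T := T) setT.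

(* Main.v *)
Require Import Defs.
From HB Require Import structures.
From mathcomp Require Import all_boot all_order all_algebra.
From mathcomp Require Import all_classical all_reals all_analysis.
From mathcomp Require Import ring lra.
From mathcomp Require Import -(notations) multinomials.mpoly.

Set Implicit Arguments.
Unset Strict Implicit.
Unset Printing Implicit Defensive.

Import Order.TTheory GRing.Theory Num.Theory.
Import numFieldNormedType.Exports.

Local Open Scope classical_set_scope.
Local Open Scope ring_scope.

(** Lines in space are points of a plane over a two-dimensional algebra. For a
    geometry let A be the algebra R[j]/(j^2 = e), with e = 1 (elliptic), e = 0
    (Euclidean) or e = -1 (hyperbolic). A line with direction d and moment m,
    its Pluecker coordinates, is sent to the vector z = d + j m of A^3. Two
    lines are the same exactly when their vectors differ by a unit of A (for
    e = 1 the unit j exchanges a line and its dual), every vector z whose square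
    z.z is a unit is a multiple of the vector of a line, and two lines intersect
    at right angle exactly when z.w = 0 in A: the two components of z.w express
    orthogonality and coplanarity. These facts are collected in
    [coordinatizes] and proved for each geometry ([elliptic_coordinatizes],
    [hyperbolic_coordinatizes], [euclidean_coordinatizes]). Consequently the
    skewer of z and w is their cross product ([skewer]), and a configuration of
    lines is a plane configuration over A, for the polarity whose matrix is the
    identity, in which a point and its polar line have the same coordinates.

    It remains to pass from the plane theorem over R to the one over A. Connect
    and Intersect are cross products, so the conclusion consists of polynomial
    equations F(z) = 0 in the coordinates of the initial objects, which also
    satisfy polynomial equations; let I be the ideal of the polynomials that
    vanish at all their solutions in A. For e = 1 the algebra A is R x R, and
    the real theorem is applied to both components ([transfers_elliptic]). In
    the two other cases a theorem that holds on one component of the variety of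
    real solutions need not hold on the others, so one has to stay near the
    nonsingular real solution x that is given. Some polynomial p with p(x) <> 0
    makes p F vanish at all real solutions. The claim ([regular_point]) is that
    then some h with h(x) = 1 satisfies h p F \in I; thus F vanishes at every
    solution z over A for which h(z) and p(z) are units, and the norm from A to
    R turns this into a Zariski open condition on the lines.

    To prove the claim, let m be the maximal ideal of x. First, p F lies in
    I + m^k for every k, by induction on k: modulo I + m^(k+1) it is a form of
    degree k in the coordinates centred at x; the curves of real solutions with
    prescribed velocity, which exist because x is nonsingular, show that this
    form vanishes on the tangent space; hence it lies in the ideal generated by
    the linear parts of the equations, which are elements of I modulo m^2
    ([vanishing_ideal_mod]). Then Krull's intersection theorem
    ([krull_intersection]), which rests on Hilbert's basis theorem
    ([noetherian_mpoly]), provides h. *)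

(** * Polynomials in several variables and Hilbert's basis theorem *)

Local Notation mvar := (fun i => mpolyX _ (mnm1 i)).

Lemma mpoly_ring_ind (n : nat) (K : comNzRingType) (P : mpoly n K -> Prop) :
  (forall c, P (mpolyC n c)) -> (forall i, P (mvar i)) ->
  (forall p q, P p -> P q -> P (p + q)) ->
  (forall p q, P p -> P q -> P (p * q)) -> forall p, P p.
Proof.
move=> PC PX PD PM; elim/mpolyind => [|c m p _ _ Pp]; first by rewrite -mpolyC0.
apply: (PD) => //; rewrite -mul_mpolyC; apply: (PM) => //.
rewrite mpolyXE_id; elim/big_ind: _ => [|p1 q1|i _];
  [by rewrite -mpolyC1|exact: PM|].
elim: (m i) => [|k IHk]; first by rewrite expr0 -mpolyC1.
by rewrite exprS; apply: PM.
Qed.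

Lemma mmap_morph (R S S' : comNzRingType) n (f : {rmorphism R -> S})
    (pi : {rmorphism S -> S'}) (h : 'I_n -> S) (p : mpoly n R) :
  pi (mmap f h p) = mmap (pi \o f) (pi \o h) p.
Proof.
elim/mpoly_ring_ind: p => [c|i|p q IHp IHq|p q IHp IHq].
- by rewrite !mmapC.
- by rewrite !mmapX !mmap1U.
- by rewrite !rmorphD IHp IHq.
- by rewrite !rmorphM IHp IHq.
Qed.

Lemma mmap_eq (R S : comNzRingType) n (f g : {rmorphism R -> S})
    (h k : 'I_n -> S) (p : mpoly n R) :
  f =1 g -> h =1 k -> mmap f h p = mmap g k p.
Proof.
move=> fg hk; elim/mpoly_ring_ind: p => [c|i|p q IHp IHq|p q IHp IHq].
- by rewrite !mmapC; exact: fg.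
- by rewrite !mmapX !mmap1U; exact: hk.
- by rewrite !mmapD IHp IHq.
- by rewrite (rmorphM (mmap f h)) (rmorphM (mmap g k)) /= IHp IHq.
Qed.

(** The ascending chain condition, in the form in which it is used: a sequence
    cannot leave forever the ideals generated by its initial segments. *)
Definition noetherian (A : comNzRingType) : Prop :=
  forall f : nat -> A, exists N (c : nat -> A), f N = \sum_(i < N) c i * f i.

Lemma noetherian_surjection (A B : comNzRingType) (phi : {rmorphism A -> B}) :
  (forall b, exists a, phi a = b) -> noetherian A -> noetherian B.
Proof.
move=> /choice[s sK] noethA f.
have [N [c fN]] := noethA (s \o f); exists N, (phi \o c).
rewrite -[LHS]sK -[s _]/((s \o f) N) fN rmorph_sum; apply: eq_bigr => i _.
by rewrite rmorphM /= sK.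
Qed.

Lemma noetherian_field (F : fieldType) : noetherian F.
Proof.
move=> f; have [f0|f0] := eqVneq (f 0) 0.
  by exists 0%N, f; rewrite big_ord0.
by exists 1%N, (fun=> f 1 / f 0); rewrite big_ord1 divfK.
Qed.

Section HilbertBasis.

Definition span (B : comNzRingType) (f : nat -> B) (n : nat) (q : B) : Prop :=
  exists c : nat -> B, q = \sum_(i < n) c i * f i.

Section Span.
Variables (B : comNzRingType) (f : nat -> B).

Lemma spanD n p q : span f n p -> span f n q -> span f n (p + q).
Proof.
move=> [c ->] [d ->]; exists (fun i => c i + d i).
by rewrite -big_split; apply: eq_bigr => i _; rewrite mulrDl.
Qed.

Lemma spanM n a q : span f n q -> span f n (a * q).
Proof.
move=> [c ->]; exists (fun i => a * c i).
by rewrite mulr_sumr; apply: eq_bigr => i _; rewrite mulrA.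
Qed.

Lemma span_sum n m (F : nat -> B) :
  (forall i, (i < m)%N -> span f n (F i)) -> span f n (\sum_(i < m) F i).
Proof.
move=> sF; elim/big_ind: _ => [|p q|i _]; last exact: sF.
- by exists (fun=> 0); rewrite big1 // => i _; rewrite mul0r.
- exact: spanD.
Qed.

Lemma span_mem n i : (i < n)%N -> span f n (f i).
Proof.
move=> ltin; exists (fun j => (j == i)%:R).
rewrite (bigD1 (Ordinal ltin)) //= eqxx mul1r big1 ?addr0 // => j neji.
by rewrite (negbTE (_ : nat_of_ord j != i)) ?mul0r.
Qed.

Lemma span_trans (p : nat -> B) n m q :
  (forall i, (i < m)%N -> span f n (p i)) -> span p m q -> span f n q.
Proof.
move=> sp [c ->]; apply: (@span_sum n m (fun i => c i * p i)) => i /sp.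
exact: spanM.
Qed.

Lemma span_widen n m q : span f n q -> (n <= m)%N -> span f m q.
Proof.
move=> sq lenm; apply: span_trans sq => i ltin.
by apply/span_mem/(leq_trans ltin).
Qed.

End Span.

(** Hilbert's argument. If no term of [f] is in the ideal of the previous ones,
    the ideal [I] generated by [f] is not finitely generated, so one can choose
    successively [p n] in [I], of least degree outside of the ideal generated by
    the previous choices. A relation between the leading coefficients lets one
    lower the degree of some [p N] without entering that ideal. *)
Lemma noetherian_poly (A : comNzRingType) :
  noetherian A -> noetherian {poly A}.
Proof.
move=> noethA f; apply: contrapT => free_f.
have notspan n : ~ span f n (f n) by move=> [c fn]; apply: free_f; exists n, c.
pose I q := exists n, span f n q.
have ID p q : I p -> I q -> I (p + q).
  move=> [n sp] [m sq]; exists (maxn n m).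
  by apply: spanD; [apply: (span_widen sp)|apply: (span_widen sq)];
    rewrite leq_max leqnn ?orbT.
have IM a q : I q -> I (a * q) by move=> [n sq]; exists n; apply: spanM.
have Isum (m : nat) (F : nat -> {poly A}) :
    (forall i, (i < m)%N -> I (F i)) -> I (\sum_(i < m) F i).
  move=> IF; elim/big_ind: _ => [|p q|i _]; [|exact: ID|exact: IF].
  by exists 0%N, f; rewrite big_ord0.
pose inI (s : seq {poly A}) := forall i, (i < size s)%N -> I s`_i.
pose out s q := I q /\ ~ span (nth 0 s) (size s) q.
have /choice[nxt nxtP] s : exists p, inI s ->
    out s p /\ forall q, out s q -> (size p <= size q)%N.
  have [sI|] := pselect (inI s); last by exists 0.
  have [n sn] : exists n, forall i, (i < size s)%N -> span f n s`_i.
    have /choice[b bP] i : exists n, (i < size s)%N -> span f n s`_i.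
      by have [/sI[n]|_] := ltnP i (size s); [exists n|exists 0%N].
    exists (\max_(i < size s) b i)%N => i ltis; apply: (span_widen (bP i ltis)).
    exact: (leq_bigmax (Ordinal ltis)).
  have exout : exists m, `[< exists2 p, out s p & size p = m >].
    exists (size (f n)); apply/asboolP; exists (f n) => //; split.
      by exists n.+1; apply: span_mem.
    by move=> /(span_trans sn)/notspan.
  case: (ex_minnP exout) => m /asboolP[p outp <-] minp; exists p => _.
  by split=> // q outq; apply: minp; apply/asboolP; exists q.
pose L := fix L n := if n is n'.+1 then rcons (L n') (nxt (L n')) else [::].
pose p n := nxt (L n).
have szL n : size (L n) = n by elim: n => //= n IHn; rewrite size_rcons IHn.
have nthL n i : (i < n)%N -> (L n)`_i = p i.
  elim: n => // n IHn; rewrite ltnS leq_eqVlt /= nth_rcons szL.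
  by case/predU1P => [->|ltin]; rewrite ?ltnn ?eqxx ?ltin ?IHn.
have LI n : inI (L n).
  elim: n => // n IHn i; rewrite szL => ltiSn; rewrite nthL //.
  move: ltiSn; rewrite ltnS leq_eqVlt => /predU1P[->|ltin].
    by have [[Ipn _] _] := nxtP _ IHn.
  by rewrite -(nthL n) //; apply: IHn; rewrite szL.
have outE n q : out (L n) q <-> I q /\ ~ span p n q.
  rewrite /out szL; split=> -[Iq nsq]; split=> // -[c q_eq]; apply: nsq;
  exists c; rewrite q_eq; apply: eq_bigr => i _; by rewrite nthL.
have pout n : I (p n) /\ ~ span p n (p n).
  by apply/outE; have [] := nxtP _ (LI n).
have pmin n q : I q -> ~ span p n q -> (size (p n) <= size q)%N.
  by move=> Iq nsq; have [_] := nxtP _ (LI n); apply; apply/outE.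
have p0 n : p n != 0.
  apply/eqP=> pn0; have [_ []] := pout n; exists (fun=> 0).
  by rewrite pn0 big1 // => i _; rewrite mul0r.
have szp n m : (n <= m)%N -> (size (p n) <= size (p m))%N.
  move=> lenm; have [Ip nsp] := pout m; apply: pmin => // sp.
  by apply: nsp; exact: (span_widen sp).
have [N [c leadN]] := noethA (fun n => lead_coef (p n)).
(* [q] is [p N] with its leading term cancelled by the relation. *)
pose t (i : nat) := (c i)%:P * 'X^(size (p N) - size (p i)).
pose q := p N - \sum_(i < N) t i * p i.
have [IpN nspN] := pout N.
have Iq : I q.
  apply: ID => //; rewrite -mulN1r; apply: (IM).
  apply: (@Isum N (fun i => t i * p i)).
  by move=> i _; apply: IM; have [] := pout i.
have nsq : ~ span p N q.
  move=> sq; apply: nspN; rewrite -[p N](subrK (\sum_(i < N) t i * p i)).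
  by apply: spanD => //; exists t.
have := pmin N q Iq nsq; rewrite leqNgt => /negP[].
have szN : (0 < size (p N))%N by rewrite size_poly_gt0.
rewrite -(prednK szN) ltnS; apply/leq_sizeP => j; rewrite leq_eqVlt.
have szt i : (i < N)%N -> (size (t i * p i)%R <= size (p N))%N.
  move=> ltiN; rewrite /t -mulrA mul_polyC; apply: leq_trans (size_scale_leq _ _) _.
  by rewrite mulrC size_mulXn ?p0 // subnK //; exact/szp/ltnW.
case/predU1P => [<-|ltj]; last first.
  apply: nth_default; apply: leq_trans (_ : (size (p N) <= j)%N); last first.
    by rewrite -(prednK szN).
  apply: leq_trans (size_polyD _ _) _.
  rewrite geq_max leqnn size_polyN /=.
  apply: (big_ind (fun r : {poly A} => (size r <= size (p N))%N)).
  - by rewrite size_poly0.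
  - by move=> r s szr szs; apply: leq_trans (size_polyD _ _) _; rewrite geq_max szr.
  - by move=> i _; apply: szt.
rewrite coefB -[(p N)`_ _]/(lead_coef (p N)) leadN coef_sum -sumrB big1 // => i _.
rewrite /t -mulrA coefCM coefXnM.
have leiN : (size (p i) <= size (p N))%N by apply/szp/ltnW.
have szi : (0 < size (p i))%N by rewrite size_poly_gt0.
case: ltnP => [|_].
  by rewrite ltnNge -{1}(prednK szN) -{1}(prednK szi) subSS leq_subr.
rewrite /lead_coef.
suff -> : ((size (p N)).-1 - (size (p N) - size (p i)) = (size (p i)).-1)%N.
  by rewrite subrr.
move: leiN szN szi; case: (size (p N)) => // a; case: (size (p i)) => // b ltba.
by rewrite subSS /= subKn.
Qed.

End HilbertBasis.

(** The last variable of a polynomial in [n.+1] variables is set apart. *)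
Definition mpoly_of_poly (n : nat) (A : comNzRingType) :
    {rmorphism {poly mpoly n A} -> mpoly n.+1 A} :=
  horner_eval (mpolyX A (mnm1 ord_max)) \o map_poly (@mwiden n A).

Lemma mpoly_of_polyP (n : nat) (A : comNzRingType) (p : mpoly n.+1 A) :
  exists q, mpoly_of_poly n A q = p.
Proof.
elim/mpoly_ring_ind: p => [c|i|p q [a <-] [b <-]|p q [a <-] [b <-]].
- by exists (mpolyC n c)%:P; rewrite /= map_polyC /horner_eval hornerC /= mwidenC.
- have [j ->|->] := unliftP ord_max i; last first.
    by exists 'X; rewrite /= map_polyX /horner_eval hornerX.
  exists (mpolyX A (mnm1 j))%:P; rewrite /= map_polyC /horner_eval hornerC /=.
  rewrite mwidenX mnmwiden1; congr (mpolyX _ (mnm1 _)).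
  by apply: val_inj; rewrite /= /bump leqNgt ltn_ord.
- by exists (a + b); rewrite rmorphD.
- by exists (a * b); rewrite rmorphM.
Qed.

Lemma noetherian_mpoly (n : nat) (A : comNzRingType) :
  noetherian A -> noetherian (mpoly n A).
Proof.
move=> noethA; elim: n => [|n /noetherian_poly].
  pose phi : {rmorphism A -> mpoly 0 A} := @mpolyC 0 A.
  apply: (@noetherian_surjection _ _ phi) noethA => p.
  elim/mpoly_ring_ind: p => [c|[]//|p q [a <-] [b <-]|p q [a <-] [b <-]].
  - by exists c.
  - by exists (a + b); rewrite rmorphD.
  - by exists (a * b); rewrite rmorphM.
exact/noetherian_surjection/mpoly_of_polyP.
Qed.

(** * Powers of an ideal and Krull's intersection theorem *)

Definition is_ideal (A : comNzRingType) (I : A -> Prop) : Prop :=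
  [/\ I 0, forall p q, I p -> I q -> I (p + q) & forall a q, I q -> I (a * q)].

Section IdealPowers.
Variables (A : comNzRingType) (n : nat) (a : 'I_n -> A).

(** The [k]-th power of the ideal generated by the [a i]. *)
Fixpoint in_power (k : nat) (p : A) : Prop :=
  if k is k'.+1 then
    exists q : 'I_n -> A, (forall i, in_power k' (q i)) /\ p = \sum_i a i * q i
  else True.

Lemma in_power0 k : in_power k 0.
Proof.
elim: k => //= k IHk; exists (fun=> 0); split => //.
by rewrite big1 // => i _; rewrite mulr0.
Qed.

Lemma in_powerD k p q : in_power k p -> in_power k q -> in_power k (p + q).
Proof.
elim: k p q => //= k IHk _ _ [p [kp ->]] [q [kq ->]].
exists (fun i => p i + q i); split => [i|]; first exact: IHk.
by rewrite -big_split; apply: eq_bigr => i _; rewrite mulrDr.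
Qed.

Lemma in_powerM k b p : in_power k p -> in_power k (b * p).
Proof.
elim: k p => //= k IHk _ [p [kp ->]].
exists (fun i => b * p i); split => [i|]; first exact: IHk.
by rewrite mulr_sumr; apply: eq_bigr => i _; rewrite mulrCA.
Qed.

Lemma in_powerS k i p : in_power k p -> in_power k.+1 (a i * p).
Proof.
move=> kp; exists (fun j => if j == i then p else 0); split => [j|].
  by case: eqP => // _; exact: in_power0.
rewrite (bigD1 i) //= eqxx big1 ?addr0 // => j /negbTE ->.
by rewrite mulr0.
Qed.

Lemma in_powerMM j k p q : in_power j p -> in_power k q -> in_power (j + k) (p * q).
Proof.
move=> + kq; elim: j p => [|j IHj] p /=; first by move=> _; apply: in_powerM.
case=> b [jb ->]; exists (fun i => b i * q); split => [i|]; first exact: IHj.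
by rewrite mulr_suml; apply: eq_bigr => i _; rewrite mulrA.
Qed.

(** Krull's intersection theorem modulo [I], for the ideal m generated by the
    [a i]. If [F] is congruent to some [G k] in m^k for every [k], then [G k X^k]
    is in the Rees algebra of m, the image of [Phi] below. This algebra is
    Noetherian, so [G N X^N] is a combination of the [G i X^i] with [i < N];
    comparing the coefficients of [X^N], whose contributions from the Rees
    algebra have positive degree and are thus in m, one gets [F = c F] modulo
    [I], with [c] in m. *)
Lemma krull_intersection (S : comNzRingType) (ev : {rmorphism A -> S})
    (I : A -> Prop) (F : A) :
  noetherian A -> is_ideal I -> (forall i, ev (a i) = 0) ->
  (forall k, exists p, in_power k p /\ I (F - p)) ->
  exists2 h, ev h = 1 & I (h * F).
Proof.
move=> noethA [I0 ID IM] ev_a /choice[G /all_and2[powG FG]].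
pose Phi : {rmorphism mpoly n A -> {poly A}} :=
  mmap (@polyC A) (fun i => (a i)%:P * 'X).
have PhiX i : Phi (mpolyX A (mnm1 i)) = (a i)%:P * 'X by rewrite /= mmapX mmap1U.
have PhiC c : Phi (mpolyC n c) = c%:P by rewrite /= mmapC.
have lift k p : in_power k p -> exists l, Phi l = p%:P * 'X^k.
  elim: k p => [|k IHk] p /=.
    by exists (mpolyC n p); rewrite PhiC mulr1.
  case=> q [kq ->]; have /choice[l lP] i := IHk _ (kq i).
  exists (\sum_i mpolyX A (mnm1 i) * l i).
  rewrite rmorph_sum /= (rmorph_sum (@polyC A)) mulr_suml; apply: eq_bigr => i _.
  rewrite [in LHS]rmorphM PhiX lP exprS /= polyCM -!mulrA; congr (_ * _).
  by rewrite mulrCA.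
have coef_Phi q d : (0 < d)%N -> ev (Phi q)`_d = 0.
  elim/mpoly_ring_ind: q d => [c|i|p q IHp IHq|p q IHp IHq] d d_gt0.
  - by rewrite PhiC coefC gtn_eqF ?rmorph0.
  - by rewrite PhiX coefCM rmorphM ev_a mul0r.
  - by rewrite rmorphD coefD rmorphD IHp // IHq // addr0.
  rewrite rmorphM coefM rmorph_sum big1 // => j _; rewrite rmorphM.
  have [j0|j_gt0] := posnP j; last by rewrite IHp ?mul0r.
  by rewrite [X in _ * X]IHq ?mulr0 // j0 subn0.
have [l lP] := choice (fun k => lift k _ (powG k)).
have [N [c lN]] := @noetherian_mpoly n A noethA l.
pose e i := (Phi (c i))`_(N - i).
have GN : G N = \sum_(i < N) e i * G i.
  have /(congr1 (fun p => (Phi p)`_N)) := lN.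
  rewrite lP coefCM coefXn eqxx mulr1 => ->; rewrite rmorph_sum coef_sum.
  apply: eq_bigr => i _; rewrite rmorphM lP mulrCA coefCM coefMXn ltnNge ltnW //=.
  by rewrite mulrC.
exists (1 - \sum_(i < N) e i).
  rewrite rmorphB rmorph1 rmorph_sum big1 ?subr0 // => i _.
  by rewrite coef_Phi ?subn_gt0.
have -> : (1 - \sum_(i < N) e i) * F = (F - G N) + \sum_(i < N) (- e i) * (F - G i).
  rewrite GN mulrBl mul1r mulr_suml -addrA; congr (_ + _).
  rewrite -!sumrN -big_split; apply: eq_bigr => i _.
  by rewrite /= mulrBr !mulNr opprK addrCA addNr addr0.
apply: (ID) => //; elim/big_ind: _ => // i _; exact: IM.
Qed.

End IdealPowers.

Lemma poly_vanishing (R : numDomainType) (p : {poly R}) :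
  (forall t, p.[t] = 0) -> p = 0.
Proof.
move=> p0; apply/eqP; apply: contraT => nz_p.
have /= := @max_poly_roots _ p [seq k%:R | k <- iota 0 (size p)] nz_p.
rewrite size_map size_iota ltnn; apply.
  by apply/allP => _ /mapP[k _ ->]; apply/eqP/p0.
rewrite map_inj_uniq ?iota_uniq // => i j /eqP.
by rewrite eqr_nat => /eqP.
Qed.

Lemma mpoly_vanishing (R : numDomainType) (n : nat) (p : mpoly n R) :
  (forall v, meval v p = 0) -> p = 0.
Proof.
elim: n p => [|n IHn] p p0.
  have [c pc] : exists c, p = mpolyC 0 c.
    elim/mpoly_ring_ind: p {p0} => [c|[]//|p q [c ->] [d ->]|p q [c ->] [d ->]].
    - by exists c.
    - by exists (c + d); rewrite rmorphD.
    - by exists (c * d); rewrite rmorphM.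
  by move: (p0 (fun=> 0)); rewrite pc mevalC => ->; rewrite mpolyC0.
have [q pq] := mpoly_of_polyP p.
suff q0 : q = 0 by rewrite -pq q0 rmorph0.
apply/polyP => i; rewrite coef0; apply: IHn => v.
have : map_poly (meval v) q = 0.
  apply: poly_vanishing => t.
  pose u (j : 'I_n.+1) := if unlift ord_max j is Some j' then v j' else t.
  have := p0 u; rewrite -pq.
  suff -> : meval u (mpoly_of_poly n R q) = (map_poly (meval v) q).[t] by [].
  have -> : t = u ord_max by rewrite /u unlift_none.
  rewrite /mpoly_of_poly /= /horner_eval -[meval u _.[_]]horner_map /= mevalXU.
  rewrite -map_poly_comp; congr (_.[_]); apply: eq_map_poly => r /=.
  elim/mpoly_ring_ind: r => [c|j|r s IHr IHs|r s IHr IHs].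
  - by rewrite mwidenC !mevalC.
  - rewrite mwidenX mnmwiden1 !mevalXU /u.
    have -> : widen_ord (leqnSn n) j = lift ord_max j.
      by apply: val_inj; rewrite /= /bump leqNgt ltn_ord.
    by rewrite liftK.
  - by rewrite !rmorphD /= IHr IHs.
  - by rewrite !rmorphM /= IHr IHs.
by move/polyP/(_ i); rewrite coef_map coef0.
Qed.

(** * Polynomials that vanish near a regular real point *)

Section RegularPoint.
Variables (R : realType) (n : nat) (x : 'I_n -> R).
Notation poly_n := (mpoly n R).

(** The generators of the maximal ideal m of the point [x]. *)
Definition local_coord (i : 'I_n) : poly_n := mpolyX R (mnm1 i) - mpolyC n (x i).
Local Notation a := local_coord.

Lemma meval_local_coord i v : meval v (a i) = v i - x i.
Proof. by rewrite mevalB mevalXU mevalC. Qed.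

Lemma first_order_expansion (p : poly_n) :
  exists q : 'I_n -> poly_n, p = mpolyC n (meval x p) + \sum_i a i * q i.
Proof.
elim/mpoly_ring_ind: p => [c|i|p q [p1 pE] [q1 qE]|p q [p1 pE] [q1 qE]].
- by exists (fun=> 0); rewrite mevalC big1 ?addr0 // => i _; rewrite mulr0.
- exists (fun j => (j == i)%:R); rewrite mevalXU (bigD1 i) //= eqxx mulr1.
  rewrite big1 => [|j /negbTE ->]; last by rewrite mulr0.
  by rewrite addr0 addrC subrK.
- exists (fun i => p1 i + q1 i).
  under eq_bigr do rewrite mulrDr.
  by rewrite mevalD mpolyCD big_split /= addrACA -pE -qE.
- exists (fun i => p1 i * q + mpolyC n (meval x p) * q1 i).
  under eq_bigr do rewrite mulrDr mulrA mulrCA.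
  rewrite big_split /= -mulr_suml -mulr_sumr mevalM mpolyCM.
  by rewrite addrCA -mulrDr -qE addrC -mulrDl -pE.
Qed.

(** Forms of degree [k] with constant coefficients, in the local coordinates. *)
Fixpoint local_form (k : nat) (f : poly_n) : Prop :=
  if k is k'.+1 then
    exists q : 'I_n -> poly_n,
      (forall i, local_form k' (q i)) /\ f = \sum_i a i * q i
  else exists c, f = mpolyC n c.

Lemma leading_form k p : in_power a k p ->
  exists f r, [/\ local_form k f, in_power a k.+1 r & p = f + r].
Proof.
elim: k p => [p _|k IHk p [q [kq ->]]].
  have [q pE] := first_order_expansion p.
  exists (mpolyC n (meval x p)), (\sum_i a i * q i).
  by split => //; [exists (meval x p)|exists q].
have /choice[f fP] i := IHk _ (kq i); have /choice[r frP] := fP.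
exists (\sum_i a i * f i), (\sum_i a i * r i); split.
- by exists f; split => // i; have [] := frP i.
- by exists r; split => // i; have [] := frP i.
- rewrite -big_split; apply: eq_bigr => i _; rewrite /= -mulrDr.
  by have [_ _ ->] := frP i.
Qed.

Lemma meval_local_form k f t w : local_form k f ->
  meval (fun i => x i + t * w i) f = t ^+ k * meval (fun i => x i + w i) f.
Proof.
elim: k f => [|k IHk] f /= => [[c ->]|[q [kq ->]]].
  by rewrite !mevalC mul1r.
rewrite !raddf_sum mulr_sumr; apply: eq_bigr => i _.
rewrite /= !mevalM !meval_local_coord IHk //.
by rewrite (addrC (x i) (t * _)) (addrC (x i)) !addrK exprS; ring.
Qed.

Lemma cvg_meval (F : set_system R) (FF : Filter F) (u : R -> 'I_n -> R)
    (l : 'I_n -> R) (p : poly_n) :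
  (forall i, u t i @[t --> F] --> l i) ->
  meval (u t) p @[t --> F] --> meval l p.
Proof.
move=> ul; elim/mpoly_ring_ind: p => [c|i|p q IHp IHq|p q IHp IHq].
- by under eq_fun do rewrite mevalC; rewrite mevalC; apply: cvg_cst.
- by under eq_fun do rewrite mevalXU; rewrite mevalXU; exact: ul.
- by under eq_fun do rewrite mevalD; rewrite mevalD; apply: cvgD.
- by under eq_fun do rewrite mevalM; rewrite mevalM; apply: cvgM.
Qed.

(** Makes the terms of higher order negligible when a polynomial is restricted to
    the curve [x + t w(t)], whose velocity at [x] is [v]. *)
Lemma cvg_in_power (F : set_system R) (FF : Filter F) (w : R -> 'I_n -> R)
    (v : 'I_n -> R) k (p : poly_n) :
  F --> (0 : R) -> (forall i, w t i @[t --> F] --> v i) -> in_power a k p ->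
  exists (s : R -> R) (l : R), s t @[t --> F] --> l /\
    forall t, meval (fun i => x i + t * w t i) p = t ^+ k * s t.
Proof.
move=> F0 wv; elim: k p => [p _|k IHk p [q [kq ->]]].
  exists (fun t => meval (fun i => x i + t * w t i) p).
  exists (meval (fun i => x i + 0 * v i) p).
  split => [|t]; last by rewrite mul1r.
  by apply: cvg_meval => i; apply: cvgD; [apply: cvg_cst|apply: cvgM].
have /choice[s /choice[l sl]] i := IHk _ (kq i).
exists (fun t => \sum_i w t i * s i t), (\sum_i v i * l i); split => [|t].
  apply: cvg_big => // [|i _]; first exact: add_continuous.
  by apply: cvgM => //; have [] := sl i.
rewrite raddf_sum mulr_sumr; apply: eq_bigr => i _ /=.
have [_ qE] := sl i.
by rewrite mevalM meval_local_coord qE (addrC (x i)) addrK exprS; ring.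
Qed.

Variable I : poly_n -> Prop.
Hypothesis idealI : is_ideal I.

(** The ideal I + m^k. *)
Definition ideal_mod (k : nat) (p : poly_n) : Prop :=
  exists q, in_power a k q /\ I (p - q).

Lemma ideal_modD k p q : ideal_mod k p -> ideal_mod k q -> ideal_mod k (p + q).
Proof.
have [_ ID _] := idealI.
move=> [p' [kp Ip]] [q' [kq Iq]]; exists (p' + q'); split; first exact: in_powerD.
by rewrite opprD addrACA; apply: ID.
Qed.

Lemma ideal_modM j k p q :
  ideal_mod j p -> in_power a k q -> ideal_mod (j + k) (p * q).
Proof.
have [_ _ IM] := idealI.
move=> [p' [jp Ip]] kq; exists (p' * q); split; first exact: in_powerMM.
by rewrite -mulrBl mulrC; apply: IM.
Qed.

Lemma ideal_mod_sum j (F : 'I_j -> poly_n) k :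
  (forall i, ideal_mod k (F i)) -> ideal_mod k (\sum_i F i).
Proof.
move=> sF; elim/big_ind: _ => // [|p q]; last exact: ideal_modD.
by have [I0 _ _] := idealI; exists 0; rewrite subrr; split => //; apply: in_power0.
Qed.

Lemma ideal_mod_ideal k p : I p -> ideal_mod k p.
Proof. by move=> Ip; exists 0; rewrite subr0; split => //; apply: in_power0. Qed.

Lemma ideal_mod_power k p : in_power a k p -> ideal_mod k p.
Proof. by move=> kp; exists p; rewrite subrr; split => //; case: idealI. Qed.

Section Jacobian.
Variables (r : nat) (L : 'I_r -> poly_n) (Q : 'I_r -> 'I_n -> poly_n).
Hypothesis IL : forall l, I (L l).
Hypothesis LE : forall l, L l = \sum_i a i * Q l i.
Variable G : poly_n.
Hypothesis curves : forall v : 'I_n -> R,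
  (forall l, \sum_i meval x (Q l i) * v i = 0) ->
  exists w : R -> 'I_n -> R, (forall i, w t i @[t --> 0^'] --> v i) /\
    forall p, I p \/ p = G ->
      \forall t \near 0^', meval (fun i => x i + t * w t i) p = 0.

(* [E] is idempotent with the kernel of [J], the tangent space, as its kernel;
   its rows are combinations of the rows of [J], the linear parts of the [L l]. *)
Let J : 'M[R]_(r, n) := \matrix_(l, i) meval x (Q l i).
Let E : 'M[R]_n := pinvmx J *m J.

(** The components of the projection of [a] to the tangent space along the image
    of [E]. *)
Definition straightened (i : 'I_n) : poly_n :=
  a i - \sum_j mpolyC n (E i j) * a j.
Local Notation b := straightened.

(** The linear forms that vanish on the tangent space are combinations of the
    linear parts of the [L l], which agree with the [L l] modulo m^2. *)
Lemma sub_straightened i : ideal_mod 2 (a i - b i).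
Proof.
have in_power2 l : in_power a 2 (L l - \sum_j mpolyC n (J l j) * a j).
  rewrite LE -sumrB; exists (fun i => Q l i - mpolyC n (meval x (Q l i))).
  split=> [j|]; last first.
    by apply: eq_bigr => j _; rewrite mxE [RHS]mulrBr [X in _ - X = _]mulrC.
  have [q QE] := first_order_expansion (Q l j); exists q; split => //.
  by rewrite {1}QE addrC addKr.
rewrite /b subKr.
have -> : \sum_j mpolyC n (E i j) * a j =
    \sum_l (mpolyC n (pinvmx J i l) * L l
            - mpolyC n (pinvmx J i l) * (L l - \sum_j mpolyC n (J l j) * a j)).
  under [RHS]eq_bigr do rewrite -mulrBr subKr mulr_sumr.
  rewrite exchange_big; apply: eq_bigr => j _ /=.
  rewrite mxE rmorph_sum mulr_suml; apply: eq_bigr => l _.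
  by rewrite rmorphM mulrA.
apply: ideal_mod_sum => l; apply: ideal_modD; last first.
  by apply: ideal_mod_power; rewrite -mulNr; apply: in_powerM.
by apply: ideal_mod_ideal; have [_ _] := idealI; apply.
Qed.

(* The substitution which composes a polynomial with the projection to the
   tangent space at [x]. *)
Let sigma : {rmorphism poly_n -> poly_n} :=
  mmap (@mpolyC n R) (fun i => mpolyC n (x i) + b i).

Lemma sigma_coord i : sigma (a i) = b i.
Proof. by rewrite rmorphB /= mmapX mmap1U mmapC addrC addKr. Qed.

Lemma in_power_straightened i : in_power a 1 (b i).
Proof.
rewrite /b; apply: in_powerD.
  by rewrite -[a i]mulr1; apply: in_powerS.
rewrite -sumrN; elim/big_ind: _ => [|p q|j _]; [exact: in_power0|exact: in_powerD|].
by rewrite mulrC -mulrN; apply: in_powerS.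
Qed.

Lemma local_form_sigma k f : local_form k f ->
  in_power a k (sigma f) /\ ideal_mod k.+1 (f - sigma f).
Proof.
elim: k f => [|k IHk] f => [[c ->]|[q [kq ->]]].
  by split=> //; rewrite /= mmapC subrr; apply: ideal_mod_ideal; case: idealI.
rewrite rmorph_sum.
have sE i : sigma (a i * q i) = b i * sigma (q i) by rewrite rmorphM sigma_coord.
split.
  elim/big_ind: _ => [|p p'|i _]; [exact: in_power0|exact: in_powerD|].
  rewrite sE; apply: (@in_powerMM _ _ a 1); first exact: in_power_straightened.
  by have [] := IHk _ (kq i).
rewrite -sumrB; apply: ideal_mod_sum => i; rewrite sE.
have -> : a i * q i - b i * sigma (q i) =
    (a i - b i) * sigma (q i) + (q i - sigma (q i)) * a i by ring.
have [sq qsq] := IHk _ (kq i); apply: ideal_modD.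
  by apply: (@ideal_modM 2 k) => //; apply: sub_straightened.
rewrite -[k.+2]addn1; apply: ideal_modM => //.
by rewrite -[a i]mulr1; apply: in_powerS.
Qed.

(** A real polynomial is determined by its values, and the values of [sigma f]
    are values of [f] on the tangent space. *)
Lemma sigma_eq0 k f : local_form k f ->
  (forall v, (forall l, \sum_i meval x (Q l i) * v i = 0) ->
     meval (fun i => x i + v i) f = 0) ->
  sigma f = 0.
Proof.
move=> kf f0; apply: mpoly_vanishing => u.
pose d := \col_i (u i - x i).
pose v := d - E *m d.
have vE i : v i 0 = (u i - x i) - \sum_j E i j * (u j - x j).
  rewrite /v; move: (E) => E'; rewrite !mxE; congr (_ - _).
  by apply: eq_bigr => j _; rewrite mxE.
have -> : meval u (sigma f) = meval (fun i => x i + v i 0) f.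
  elim/mpoly_ring_ind: {kf f0} f => [c|i|p q IHp IHq|p q IHp IHq].
  - by rewrite /= mmapC !mevalC.
  - rewrite /= mmapX mmap1U mevalXU mevalD mevalC mevalB meval_local_coord.
    rewrite vE (raddf_sum (meval u)); congr (_ + (_ - _)); apply: eq_bigr => j _ /=.
    by rewrite mevalM mevalC meval_local_coord.
  - by rewrite rmorphD !mevalD IHp IHq.
  - by rewrite rmorphM !mevalM IHp IHq.
apply: f0 => l.
have : (J *m v) l 0 = 0.
  by rewrite mulmxBr mulmxA [J *m E]mulmxA mulmxKpV // subrr mxE.
by move=> Jv; rewrite -[RHS]Jv [RHS]mxE; apply: eq_bigr => i _; rewrite [J l i]mxE.
Qed.

(** The induction step: the leading form [f] of an element congruent to [G]
    vanishes on the tangent space, because along a curve with velocity [v] it is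
    the limit of [t^-k G]. *)
Lemma vanishing_ideal_mod k : ideal_mod k G.
Proof.
elim: k => [|k [p [kp Ip]]]; first by apply: ideal_mod_power.
have [f [s [kf ks pE]]] := leading_form kp.
suff sf0 : sigma f = 0.
  have -> : G = (G - p) + ((f - sigma f) + s).
    by rewrite sf0 subr0 -pE subrK.
  apply: ideal_modD; first exact: ideal_mod_ideal.
  by apply: ideal_modD; [have [] := local_form_sigma kf|apply: ideal_mod_power].
apply: (sigma_eq0 kf) => v /curves[w [wv wI]].
have id0 : (0 : R)^' --> (0 : R) by exact: nbhs_dnbhs.
have [h [l [hl hE]]] := cvg_in_power _ id0 wv ks.
have lim1 : meval (fun i => x i + w t i) f @[t --> 0^'] -->
    meval (fun i => x i + v i) f.
  by apply: cvg_meval => i; apply: cvgD => //; apply: cvg_cst.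
have lim2 : - (t * h t) @[t --> 0^'] --> - (0 * l).
  by apply: cvgN; apply: cvgM.
have : meval (fun i => x i + w t i) f @[t --> 0^'] --> - (0 * l).
  apply: cvg_trans lim2; apply: near_eq_cvg.
  have /= I1 := wI _ (or_introl Ip); have /= I2 := wI _ (or_intror erefl).
  near=> t.
  have t0 : t != 0 by near: t; exact: nbhs_dnbhs_neq.
  have e1 : meval (fun i => x i + t * w t i) (G - p) = 0 by near: t.
  have e2 : meval (fun i => x i + t * w t i) G = 0 by near: t.
  move: e1; rewrite mevalB e2 sub0r pE mevalD hE (meval_local_form _ _ kf) => /eqP.
  rewrite oppr_eq0 exprSr -mulrA -mulrDr mulf_eq0 expf_eq0 (negbTE t0) andbF /=.
  by rewrite addr_eq0 => /eqP ->.
move=> lim3; have -> := cvg_unique _ lim1 lim3; last exact: Rhausdorff.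
by rewrite mul0r oppr0.
Unshelve. all: by end_near.
Qed.

(** A real point is regular when every tangent vector is the velocity of a curve
    of real zeros of the equations; then the ideal [I] contains, up to a
    multiplier which does not vanish at [x], all that vanishes on these curves. *)
Lemma regular_point : exists2 h, meval x h = 1 & I (h * G).
Proof.
pose ev : {rmorphism poly_n -> R} := meval x.
apply: (@krull_intersection _ n a _ ev) => //.
- exact/noetherian_mpoly/noetherian_field.
- by move=> i; rewrite /= meval_local_coord subrr.
- exact: vanishing_ideal_mod.
Qed.

End Jacobian.
End RegularPoint.

(** * The algebra of a geometry, vectors over it, and constructions *)

(** The square of the generator [j] of the algebra [gnumber]. *)
Definition unit_square (g : geometry) : int :=
  match g with Elliptic => 1 | Euclidean => 0 | Hyperbolic => -1 end.

(** The pair [(a, b)] stands for [a + j b]: split-complex numbers for the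
    elliptic geometry, dual numbers for the Euclidean one, complex numbers for
    the hyperbolic one. *)
Definition gnumber (g : geometry) (K : comNzRingType) : Type := (K * K)%type.

Section GNumberRing.
Variables (g : geometry) (K : comNzRingType).
Notation A := (gnumber g K).
Notation e := ((unit_square g)%:~R : K).

HB.instance Definition _ := GRing.Zmodule.copy A (K * K)%type.

Definition gmul (x y : A) : A :=
  (x.1 * y.1 + e * (x.2 * y.2), x.1 * y.2 + x.2 * y.1).
Definition gone : A := (1, 0).

Fact gmulA : associative gmul.
Proof. by move=> x y z; rewrite /gmul /=; congr pair; ring. Qed.
Fact gmulC : commutative gmul.
Proof. by move=> x y; rewrite /gmul /=; congr pair; ring. Qed.
Fact gmul1 : left_id gone gmul.
Proof. by case=> x y; rewrite /gmul /gone /=; congr pair; ring. Qed.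
Fact gmulD : left_distributive gmul +%R.
Proof.
case=> x1 x2 [y1 y2] [z1 z2].
by apply: (f_equal2 (@pair K K)); rewrite /gmul /=; ring.
Qed.
Fact gone_neq0 : gone != 0.
Proof. by apply/eqP => -[] /eqP; rewrite oner_eq0. Qed.

HB.instance Definition _ :=
  GRing.Zmodule_isComNzRing.Build A gmulA gmulC gmul1 gmulD gone_neq0.

Lemma gnumberM (x y : A) : x * y = gmul x y. Proof. by []. Qed.
Lemma gnumberD (x y : A) : x + y = (x.1 + y.1, x.2 + y.2). Proof. by []. Qed.

Definition greal (c : K) : A := (c, 0).

Fact greal_is_zmod_morphism : zmod_morphism greal.
Proof. by move=> x y; congr pair; rewrite /= subrr. Qed.
Fact greal_is_monoid_morphism : monoid_morphism greal.
Proof. by split => // x y; rewrite /greal; congr pair; rewrite /=; ring. Qed.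
HB.instance Definition _ :=
  GRing.isZmodMorphism.Build K A greal greal_is_zmod_morphism.
HB.instance Definition _ :=
  GRing.isMonoidMorphism.Build K A greal greal_is_monoid_morphism.

Definition gnorm (x : A) : K := x.1 ^+ 2 - e * x.2 ^+ 2.
End GNumberRing.

Section GNumberMap.
Variables (g : geometry) (K S : comNzRingType) (f : {rmorphism K -> S}).

Definition gmap (x : gnumber g K) : gnumber g S := (f x.1, f x.2).

Fact gmap_is_zmod_morphism : zmod_morphism gmap.
Proof. by move=> x y; rewrite /gmap /= !rmorphB. Qed.
Fact gmap_is_monoid_morphism : monoid_morphism gmap.
Proof.
split => [|x y]; rewrite /gmap /= ?rmorph1 ?rmorph0 //.
by rewrite !rmorphD !rmorphM rmorph_int.
Qed.
HB.instance Definition _ :=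
  GRing.isZmodMorphism.Build _ _ gmap gmap_is_zmod_morphism.
HB.instance Definition _ :=
  GRing.isMonoidMorphism.Build _ _ gmap gmap_is_monoid_morphism.

Lemma gnorm_gmap (x : gnumber g K) : gnorm (gmap x) = f (gnorm x).
Proof. by rewrite /gnorm rmorphB !rmorphM rmorph_int. Qed.
End GNumberMap.

Section Invertible.
Variable K : comNzRingType.
Definition invertible (c : K) : Prop := exists d, d * c = 1.

Lemma invertible1 : invertible 1. Proof. by exists 1; rewrite mulr1. Qed.

Lemma invertibleM c d : invertible (c * d) <-> invertible c /\ invertible d.
Proof.
split => [[y yP]|[[y yP] [z zP]]]; last first.
  by exists (y * z); rewrite mulrACA yP zP mulr1.
by split; [exists (y * d)|exists (y * c)]; rewrite -yP; ring.
Qed.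

Lemma invertible_cancel c x : invertible c -> c * x = 0 -> x = 0.
Proof. by move=> [d dc] cx; rewrite -[x]mul1r -dc -mulrA cx mulr0. Qed.

Lemma invertible_prod (I : eqType) (s : seq I) (F : I -> K) i :
  invertible (\prod_(j <- s) F j) -> i \in s -> invertible (F i).
Proof.
elim: s => // j s IHs; rewrite big_cons => /invertibleM[Fj /IHs Fs].
by rewrite inE => /predU1P[->|/Fs].
Qed.
End Invertible.

Lemma invertible_field (F : fieldType) (c : F) : c != 0 -> invertible c.
Proof. by move=> c0; exists c^-1; rewrite mulVf. Qed.

(** [a + j b] has the inverse [(a - j b) / N(a + j b)]. *)
Lemma invertible_gnumber (g : geometry) (F : fieldType) (x : gnumber g F) :
  gnorm x != 0 <-> invertible x.
Proof.
case: x => a b; split => [nz|[[c d] /= [e1 e2]]].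
  pose N := gnorm ((a, b) : gnumber g F).
  exists (a / N , - b / N); rewrite gnumberM /gmul /N.
  by move: nz; rewrite /gnorm /= => nz; apply: (f_equal2 (@pair F F)); field.
apply/eqP => N0.
have : (c ^+ 2 - (unit_square g)%:~R * d ^+ 2) * @gnorm g F (a, b) = 1.
  transitivity ((c * a + (unit_square g)%:~R * (d * b)) ^+ 2
     - (unit_square g)%:~R * (c * b + d * a) ^+ 2).
    by rewrite /gnorm /=; ring.
  by rewrite (e1 : _ = 1) (e2 : _ = 0); ring.
by move/eqP; rewrite N0 mulr0 eq_sym oner_eq0.
Qed.

Local Notation o0 := (@Ordinal 3 0 isT).
Local Notation o1 := (@Ordinal 3 1 isT).
Local Notation o2 := (@Ordinal 3 2 isT).

Lemma ord3P (P : 'I_3 -> Prop) : P o0 -> P o1 -> P o2 -> forall k, P k.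
Proof.
move=> P0 P1 P2 [[|[|[|//]]] lt3]; [move: P0|move: P1|move: P2];
  by congr P; apply: val_inj.
Qed.

Definition vec3 (K : Type) (a b c : K) : 'rV[K]_3 :=
  \row_k match val k with 0%N => a | 1%N => b | _ => c end.

Section Vectors.
Variable K : comNzRingType.
Implicit Types u v w : 'rV[K]_3.

Definition dot u v : K := u 0 o0 * v 0 o0 + u 0 o1 * v 0 o1 + u 0 o2 * v 0 o2.
Definition cross u v : 'rV[K]_3 :=
  vec3 (u 0 o1 * v 0 o2 - u 0 o2 * v 0 o1)
       (u 0 o2 * v 0 o0 - u 0 o0 * v 0 o2)
       (u 0 o0 * v 0 o1 - u 0 o1 * v 0 o0).

Lemma row3P u v :
  u 0 o0 = v 0 o0 -> u 0 o1 = v 0 o1 -> u 0 o2 = v 0 o2 -> u = v.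
Proof. by move=> e0 e1 e2; apply/rowP; apply: ord3P. Qed.

Lemma mulmx_tr_dot m (u : 'M[K]_(m, 3)) n (v : 'M[K]_(n, 3)) i j :
  (u *m v^T) i j = dot (row i u) (row j v).
Proof.
rewrite !mxE !big_ord_recl big_ord0 addr0 /dot !mxE addrA.
by congr (_ * _ + _ * _ + _ * _); congr (_ _ _); apply: val_inj.
Qed.

Lemma row1_id (u : 'rV[K]_3) : row 0 u = u.
Proof. by apply/rowP => k; rewrite mxE. Qed.

Lemma dot_mulmx_tr u v : u *m v^T = 0 <-> dot u v = 0.
Proof.
split => [uv|uv]; first by rewrite -(row1_id u) -(row1_id v) -mulmx_tr_dot uv mxE.
by apply/matrixP => i j; rewrite !ord1 mulmx_tr_dot !row1_id uv mxE.
Qed.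

Ltac vec_ring := rewrite /dot /cross ?mxE /=; ring.

Lemma dotC u v : dot u v = dot v u. Proof. vec_ring. Qed.
Lemma dotDl u v w : dot (u + v) w = dot u w + dot v w. Proof. vec_ring. Qed.
Lemma dotBl u v w : dot (u - v) w = dot u w - dot v w. Proof. vec_ring. Qed.
Lemma dotZl a u v : dot (a *: u) v = a * dot u v. Proof. vec_ring. Qed.
Lemma dotDr u v w : dot w (u + v) = dot w u + dot w v. Proof. vec_ring. Qed.
Lemma dotBr u v w : dot w (u - v) = dot w u - dot w v. Proof. vec_ring. Qed.
Lemma dotZr a u v : dot v (a *: u) = a * dot v u. Proof. vec_ring. Qed.
Lemma dot0l u : dot 0 u = 0. Proof. vec_ring. Qed.

Lemma dot_crossl u v : dot u (cross u v) = 0. Proof. vec_ring. Qed.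
Lemma dot_crossr u v : dot v (cross u v) = 0. Proof. vec_ring. Qed.
Lemma cross0l u : cross 0 u = 0. Proof. by apply: row3P; vec_ring. Qed.
Lemma cross0r u : cross u 0 = 0. Proof. by apply: row3P; vec_ring. Qed.
Lemma crossZl a u v : cross (a *: u) v = a *: cross u v.
Proof. by apply: row3P; vec_ring. Qed.
Lemma crossZr a u v : cross u (a *: v) = a *: cross u v.
Proof. by apply: row3P; vec_ring. Qed.
Lemma crossvv u : cross u u = 0.
Proof. by apply: row3P; vec_ring. Qed.

Lemma cross_cross u v w :
  cross u (cross v w) = dot u w *: v - dot u v *: w.
Proof. by apply: row3P; vec_ring. Qed.

Lemma cross0_parallel u v :
  cross u v = 0 -> dot u u *: v = dot u v *: u.
Proof.
move=> uv; apply/eqP; rewrite -subr_eq0 -opprB oppr_eq0.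
by rewrite -cross_cross uv cross0r.
Qed.

(** Over a ring there is no dimension argument; the vector that is orthogonal to
    [v] and [w] is found from the double product [n x (u x n)], where [u x n]
    vanishes. *)
Lemma orthogonal_cross u v w : dot u v = 0 -> dot u w = 0 ->
  dot (cross v w) (cross v w) *: u = dot u (cross v w) *: cross v w.
Proof.
move=> uv uw; set n := cross v w; apply/eqP; rewrite -subr_eq0.
have un : cross u n = 0 by rewrite cross_cross uv uw !scale0r subrr.
by rewrite [dot u n]dotC -cross_cross un cross0r.
Qed.

(** Equality of homogeneous coordinates. *)
Definition similar u v : Prop := exists2 c, invertible c & v = c *: u.

Lemma similar_refl u : similar u u.
Proof. by exists 1; [exact: invertible1|rewrite scale1r]. Qed.

Lemma similar_sym u v : similar u v -> similar v u.
Proof.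
case=> c [d dc] ->; exists d; first by exists c; rewrite mulrC.
by rewrite scalerA dc scale1r.
Qed.

Lemma similar_trans v u w : similar u v -> similar v w -> similar u w.
Proof.
move=> [c ci ->] [d di ->]; exists (d * c); rewrite ?scalerA //.
by apply/invertibleM.
Qed.

Lemma dot_similar u v u' v' : similar u u' -> similar v v' ->
  dot u v = 0 <-> dot u' v' = 0.
Proof.
move=> [c ci ->] [d di ->]; rewrite dotZl dotZr.
split=> [->|]; first by rewrite !mulr0.
by move=> /(invertible_cancel ci)/(invertible_cancel di).
Qed.

Lemma invertible_similar u v : similar u v ->
  invertible (dot u u) <-> invertible (dot v v).
Proof.
case=> c ci ->; rewrite dotZl dotZr mulrA.
split=> [uu|/invertibleM[]//]; apply/invertibleM; split => //.
exact/invertibleM.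
Qed.

Lemma similar_of_cross0 u v : invertible (dot u u) -> invertible (dot v v) ->
  cross u v = 0 -> similar u v.
Proof.
move=> ui vi /cross0_parallel uv; have [d du] := ui.
have vE : v = (d * dot u v) *: u by rewrite -scalerA -uv scalerA du scale1r.
exists (d * dot u v) => //; move: vi; rewrite {1}vE dotZl => /invertibleM[].
by [].
Qed.

(** Two points are joined by a single line, as soon as the square of their cross
    product is a unit. *)
Lemma similar_cross u v w : invertible (dot u u) ->
  invertible (dot (cross v w) (cross v w)) ->
  dot u v = 0 -> dot u w = 0 -> similar (cross v w) u.
Proof.
move=> ui ni uv uw; have := orthogonal_cross uv uw.
set n := cross v w in ni *; have [d dn] := ni => nu.
have uE : u = (d * dot u n) *: n by rewrite -scalerA -nu scalerA dn scale1r.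
by exists (d * dot u n) => //; move: ui; rewrite {1}uE dotZl => /invertibleM[].
Qed.

End Vectors.

Section VectorsMap.
Variables (K S : comNzRingType) (f : {rmorphism K -> S}).
Implicit Types u v : 'rV[K]_3.

Lemma map_dot u v : dot (map_mx f u) (map_mx f v) = f (dot u v).
Proof. by rewrite /dot !mxE !rmorphD !rmorphM. Qed.

Lemma map_cross u v : cross (map_mx f u) (map_mx f v) = map_mx f (cross u v).
Proof. by apply: row3P; rewrite !mxE /= rmorphB !rmorphM. Qed.
End VectorsMap.

(** The vector [d + j m]. *)
Definition gvec (g : geometry) (K : comNzRingType) (d m : 'rV[K]_3) :
  'rV[gnumber g K]_3 := \row_k (d 0 k, m 0 k).

Section GVec.
Variables (g : geometry) (K : comNzRingType).
Notation e := ((unit_square g)%:~R : K).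
Implicit Types d m : 'rV[K]_3.

Lemma dot_gvec d m d' m' : dot (gvec g d m) (gvec g d' m') =
  (dot d d' + e * dot m m', dot d m' + dot m d').
Proof.
rewrite /dot !mxE !gnumberM /gmul !gnumberD.
by apply: (f_equal2 (@pair K K)); rewrite /=; ring.
Qed.

Lemma scale_gvec a b d m : ((a, b) : gnumber g K) *: gvec g d m =
  gvec g (a *: d + (e * b) *: m) (a *: m + b *: d).
Proof.
apply/rowP => k; rewrite !mxE gnumberM /gmul.
by apply: (f_equal2 (@pair K K)); rewrite /=; ring.
Qed.

Lemma gvecP (n : 'rV[gnumber g K]_3) : exists d m, n = gvec g d m.
Proof.
exists (\row_k (n 0 k).1), (\row_k (n 0 k).2); apply/rowP => k.
by rewrite !mxE; case: (n 0 k).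
Qed.

Lemma gvec_inj d m d' m' : gvec g d m = gvec g d' m' -> d = d' /\ m = m'.
Proof.
move=> E; split; apply/rowP => k; have := congr1 (fun u : 'rV__ => u 0 k) E;
by rewrite !mxE => -[].
Qed.

Lemma gvec_real d : gvec g d 0 = map_mx (@greal g K) d.
Proof. by apply/rowP => k; rewrite !mxE. Qed.
End GVec.

(** The instructions as operations on homogeneous coordinates. With the identity
    matrix as polarity, polar objects have the same coordinates. *)
Fixpoint construct (K : comNzRingType) (s : seq instruction)
    (P L : seq 'rV[K]_3) : seq 'rV[K]_3 * seq 'rV[K]_3 :=
  match s with
  | [::] => (P, L)
  | Connect i j :: s' => construct s' P (rcons L (cross P`_i P`_j))
  | Intersect i j :: s' => construct s' (rcons P (cross L`_i L`_j)) L
  | PolarLine i :: s' => construct s' P (rcons L P`_i)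
  | PolarPoint j :: s' => construct s' (rcons P L`_j) L
  end.

Lemma nth_map_mx (K S : comNzRingType) (f : {rmorphism K -> S})
    (Z : seq 'rV[K]_3) i :
  (map (map_mx f) Z)`_i = map_mx f (Z`_i) :> 'rV_3.
Proof.
have [lti|gei] := ltnP i (size Z); first by rewrite (nth_map 0).
by rewrite !nth_default ?size_map // map_mx0.
Qed.

Lemma map_construct (K S : comNzRingType) (f : {rmorphism K -> S}) s P L :
  construct s (map (map_mx f) P) (map (map_mx f) L) =
  (map (map_mx f) (construct s P L).1, map (map_mx f) (construct s P L).2).
Proof.
elim: s P L => // [[i j|i j|i|j]] s IHs P L /=;
  by rewrite !nth_map_mx ?map_cross -map_rcons IHs.
Qed.

Lemma construct_sub (K : comNzRingType) s (P L : seq 'rV[K]_3) :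
  {subset P <= (construct s P L).1} /\ {subset L <= (construct s P L).2}.
Proof.
elim: s P L => [//|[i j|i j|i|j] s IHs] P L /=; first by split.
all: split => u uZ.
all: by [apply: (IHs _ _).1; rewrite ?mem_rcons ?inE ?uZ ?orbT
        |apply: (IHs _ _).2; rewrite ?mem_rcons ?inE ?uZ ?orbT].
Qed.

Section Equations.
Variable I : eqType.
Implicit Types inc pol : seq I.

Definition entries (K : comNzRingType) (u : 'rV[K]_3) : seq K :=
  [:: u 0 o0; u 0 o1; u 0 o2].

(** Incidence says that the dot product vanishes, and polar duality that the
    cross product does. *)
Definition equations (K : comNzRingType) (a b : I -> 'rV[K]_3) inc pol : seq K :=
  [seq dot (a c) (b c) | c <- inc] ++
  flatten [seq entries (cross (a c) (b c)) | c <- pol].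

Lemma entries_eq0 (K : comNzRingType) (u : 'rV[K]_3) :
  u = 0 <-> forall c, c \in entries u -> c = 0.
Proof.
split => [-> c|u0]; first by rewrite !inE !mxE !orbb => /eqP.
by apply: row3P; rewrite [RHS]mxE; apply: u0; rewrite !inE eqxx ?orbT.
Qed.

Lemma equationsP (K : comNzRingType) (a b : I -> 'rV[K]_3) inc pol :
  (forall c, c \in equations a b inc pol -> c = 0) <->
  (forall c, c \in inc -> dot (a c) (b c) = 0) /\
  (forall c, c \in pol -> cross (a c) (b c) = 0).
Proof.
split => [x0|[x0 x1] d].
  split => c cT; first by
    apply: x0; rewrite mem_cat; apply/orP; left; apply/mapP; exists c.
  apply/entries_eq0 => d dc; apply: x0; rewrite mem_cat; apply/orP; right.
  by apply/flattenP; eexists; [apply/mapP; exists c|exact: dc].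
rewrite mem_cat => /orP[/mapP[c cT ->]|/flattenP[_ /mapP[c cT ->]]].
  exact: x0.
by move: d; apply/entries_eq0/x1.
Qed.

Lemma map_equations (K S : comNzRingType) (f : {rmorphism K -> S})
    (a b : I -> 'rV[K]_3) (fa fb : I -> 'rV[S]_3) inc pol :
  (forall c, fa c = map_mx f (a c)) -> (forall c, fb c = map_mx f (b c)) ->
  equations fa fb inc pol = map f (equations a b inc pol).
Proof.
move=> faE fbE.
have mapE u : entries (map_mx f u) = map f (entries u).
  by rewrite /entries /= !mxE.
rewrite /equations map_cat map_flatten -!map_comp.
congr (_ ++ flatten _); apply: eq_map => c; first by rewrite faE fbE map_dot.
by rewrite faE fbE map_cross; exact: mapE.
Qed.

End Equations.

Section ConfigurationEquations.
Variable T : configuration.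

Section OverRing.
Variables (K : comNzRingType) (x : object T -> 'rV[K]_3).

Definition initial_equations : seq K :=
  equations (fun c => x (inl c.1)) (fun c => x (inr c.2))
    (init_incident T) (init_polar T).

Definition constructed : seq 'rV[K]_3 * seq 'rV[K]_3 :=
  construct (instructions T)
    [seq x (inl i) | i <- enum 'I_(npoints T)]
    [seq x (inr j) | j <- enum 'I_(nlines T)].

Definition final_equations : seq K :=
  equations (fun c => constructed.1`_(c.1)) (fun c => constructed.2`_(c.2))
    (concl_incident T) (concl_polar T).

(** The product of the squares of all objects that occur: where it is a unit, no
    step of the construction degenerates. *)
Definition discriminant : K :=
  \prod_(u <- constructed.1 ++ constructed.2) dot u u.

Lemma initial_equationsP : (forall c, c \in initial_equations -> c = 0) <->
  (forall c, c \in init_incident T -> dot (x (inl c.1)) (x (inr c.2)) = 0) /\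
  (forall c, c \in init_polar T -> cross (x (inl c.1)) (x (inr c.2)) = 0).
Proof. exact: equationsP. Qed.

Lemma final_equationsP : (forall c, c \in final_equations -> c = 0) <->
  (forall c, c \in concl_incident T ->
     dot constructed.1`_(c.1) constructed.2`_(c.2) = 0) /\
  (forall c, c \in concl_polar T ->
     cross constructed.1`_(c.1) constructed.2`_(c.2) = 0).
Proof. exact: equationsP. Qed.

Lemma discriminant_invertible u : invertible discriminant ->
  u \in constructed.1 ++ constructed.2 -> invertible (dot u u).
Proof. exact: (@invertible_prod _ _ _ (fun u => dot u u)). Qed.

Lemma object_constructed o : x o \in constructed.1 ++ constructed.2.
Proof.
rewrite mem_cat; have [subP subL] := construct_sub (instructions T)
  [seq x (inl i) | i <- enum 'I_(npoints T)]
  [seq x (inr j) | j <- enum 'I_(nlines T)].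
case: o => i; [rewrite subP|rewrite subL ?orbT] => //;
  by apply: map_f; rewrite mem_enum.
Qed.

End OverRing.

Section Map.
Variables (K S : comNzRingType) (f : {rmorphism K -> S}).
Variable x : object T -> 'rV[K]_3.
Let fx o := map_mx f (x o).

Lemma map_initial_equations :
  initial_equations fx = map f (initial_equations x).
Proof. exact: map_equations. Qed.

Lemma map_constructed : constructed fx =
  (map (map_mx f) (constructed x).1, map (map_mx f) (constructed x).2).
Proof. by rewrite /constructed -map_construct -!map_comp. Qed.

Lemma map_final_equations : final_equations fx = map f (final_equations x).
Proof.
by apply: map_equations => c; rewrite map_constructed /= nth_map_mx.
Qed.

Lemma map_discriminant : discriminant fx = f (discriminant x).
Proof.
rewrite /discriminant map_constructed /= -map_cat big_map rmorph_prod.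
by apply: eq_bigr => u _; rewrite map_dot.
Qed.
End Map.
End ConfigurationEquations.

Section GenericPoint.
Variables (R : realType) (W : world R) (T : configuration).
Notation N := #|coordinate W T|.

Definition coordinates (S : Type) (z : object T -> 'M[S]_(nrows W, ncols W))
  (k : 'I_N) : S := let c := enum_val k in z c.1 c.2.1 c.2.2.

(** The configuration whose coordinates are independent variables; all others
    are its specializations. *)
Definition generic_point (o : object T) : 'M[mpoly N R]_(nrows W, ncols W) :=
  \matrix_(i, j) mpolyX R (mnm1 (enum_rank ((o, (i, j)) : coordinate W T))).

Lemma map_generic_point (S : comNzRingType) (f : {rmorphism R -> S})
    (z : object T -> 'M[S]_(nrows W, ncols W)) :
  (fun o => map_mx (mmap f (coordinates z)) (generic_point o)) = z.
Proof.
apply/funext => o; apply/matrixP => i j.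
by rewrite !mxE mmapX mmap1U /coordinates enum_rankK.
Qed.
End GenericPoint.

(** * Plane configurations as vectors with cross products *)

Section RealVectors.
Variable R : realType.
Implicit Types u v w : 'rV[R]_3.

Lemma dot_ge0 u : 0 <= dot u u.
Proof. by rewrite /dot -!expr2 !addr_ge0 ?sqr_ge0. Qed.

Lemma dot_eq0 u : (dot u u == 0) = (u == 0).
Proof.
apply/eqP/eqP => [|->]; last by rewrite dot0l.
rewrite /dot -!expr2 => /eqP.
rewrite !paddr_eq0 ?addr_ge0 ?sqr_ge0 // !sqrf_eq0.
move=> /andP[/andP[/eqP e0 /eqP e1] /eqP e2].
by apply: row3P; rewrite mxE.
Qed.

Lemma cross_eq0 u v : u != 0 -> cross u v = 0 -> exists c, v = c *: u.
Proof.
rewrite -dot_eq0 => u0 /cross0_parallel uv; exists ((dot u u)^-1 * dot u v).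
by rewrite -scalerA -uv scalerA mulVf // scale1r.
Qed.

Lemma cross_orthogonal_neq0 u v : u != 0 -> v != 0 -> dot u v = 0 -> cross u v != 0.
Proof.
move=> u0 v0 uv; apply/eqP => /(cross_eq0 u0)[c vE].
have /eqP : dot v v = 0 by rewrite {1}vE dotZl uv mulr0.
by rewrite dot_eq0 (negbTE v0).
Qed.

(** If [u] and [v] were proportional, then [w] and [u x w] would be two different
    lines through both. *)
Lemma unique_orthogonal_cross_neq0 u v : u != 0 ->
  (exists2 w, w != 0 & dot u w = 0 /\ dot v w = 0) ->
  (forall w w', w != 0 -> w' != 0 -> dot u w = 0 -> dot v w = 0 ->
     dot u w' = 0 -> dot v w' = 0 -> proportional w w') ->
  cross u v != 0.
Proof.
move=> u0 [w w0 [uw vw]] uniq; apply/eqP => /(cross_eq0 u0)[c vE].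
have w'0 := cross_orthogonal_neq0 u0 w0 uw.
have uw' := dot_crossl u w.
have vw' : dot v (cross u w) = 0 by rewrite vE dotZl uw' mulr0.
have [d d0 dE] := uniq _ _ w0 w'0 uw vw uw' vw'.
have := dot_crossr u w; rewrite dE dotZr => /eqP.
by rewrite mulf_eq0 dot_eq0 (negbTE d0) (negbTE w0).
Qed.
End RealVectors.

Section Plane.
Variable R : realType.
Notation W := (plane (1%:M : 'M[R]_3)).

Lemma proportional1 (u v : 'rV[R]_3) :
  proportional (u *m 1%:M) v <-> proportional u v.
Proof. by rewrite mulmx1. Qed.

(** As [after] quantifies over all coordinates of the results, it can be followed
    along the particular coordinates chosen by [construct]. *)
Lemma plane_construct s (K : seq 'rV[R]_3 -> seq 'rV[R]_3 -> Prop) concl P L :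
  labels_ok s (size P) (size L) concl ->
  (forall u, u \in P ++ L -> u != 0) ->
  after (W := W) s K P L ->
  (forall u, u \in (construct s P L).1 ++ (construct s P L).2 -> u != 0) /\
  K (construct s P L).1 (construct s P L).2.
Proof.
have nz0 (Z : seq 'rV[R]_3) i :
    (forall u, u \in Z -> u != 0) -> (i < size Z)%N -> Z`_i != 0.
  by move=> Z0 lti; apply/Z0/mem_nth.
elim: s P L => [|[i j|i j|i|j] s IHs] P L /= lab PL0; first by split.
all: have P0 u : u \in P -> u != 0 by
  move=> uP; apply: PL0; rewrite mem_cat uP.
all: have L0 u : u \in L -> u != 0 by
  move=> uL; apply: PL0; rewrite mem_cat uL orbT.
all: have rP0 v : v != 0 -> forall u, u \in rcons P v ++ L -> u != 0
  by move=> v0 u; rewrite mem_cat mem_rcons inE => /orP[/predU1P[->|/P0]|/L0].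
all: have rL0 v : v != 0 -> forall u, u \in P ++ rcons L v -> u != 0
  by move=> v0 u; rewrite mem_cat mem_rcons inE => /orP[/P0|/predU1P[->|/L0]].
- case/and3P: lab => ltiP ltjP lab [[l [/= l0 il jl]] uniq K_].
  have n0 : cross P`_i P`_j != 0.
    apply: unique_orthogonal_cross_neq0; first exact: nz0.
      by exists l => //; split; apply/dot_mulmx_tr.
    move=> w w' w0 w'0 iw jw iw' jw'.
    by apply: uniq; split => //; apply/dot_mulmx_tr.
  apply: IHs; [by rewrite size_rcons|exact: rL0|apply: K_].
  by split => //; apply/dot_mulmx_tr; rewrite ?dot_crossl ?dot_crossr.
- case/and3P: lab => ltiP ltjP lab [[l [/= l0 il jl]] uniq K_].
  have n0 : cross L`_i L`_j != 0.
    apply: unique_orthogonal_cross_neq0; first exact: nz0.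
      by exists l => //; split; rewrite dotC; apply/dot_mulmx_tr.
    move=> w w' w0 w'0 iw jw iw' jw'.
    by apply: uniq; split => //; apply/dot_mulmx_tr; rewrite dotC.
  apply: IHs; [by rewrite size_rcons|exact: rP0|apply: K_].
  by split => //; apply/dot_mulmx_tr; rewrite dotC ?dot_crossl ?dot_crossr.
- case/andP: lab => ltiP lab [_ _ K_].
  have n0 := nz0 _ _ P0 ltiP.
  apply: IHs; [by rewrite size_rcons|exact: rL0|apply: K_].
  by split => //; apply/proportional1; exists 1; rewrite ?oner_eq0 ?scale1r.
- case/andP: lab => ltiP lab [_ _ K_].
  have n0 := nz0 _ _ L0 ltiP.
  apply: IHs; [by rewrite size_rcons|exact: rP0|apply: K_].
  by split => //; apply/proportional1; exists 1; rewrite ?oner_eq0 ?scale1r.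
Qed.

Variable T : configuration.
Implicit Types x : object T -> 'rV[R]_3.

Lemma proportional_cross (u v : 'rV[R]_3) : u != 0 -> v != 0 ->
  proportional u v <-> cross u v = 0.
Proof.
move=> u0 v0; split => [[c _ ->]|/(cross_eq0 u0)[c vE]].
  by rewrite crossZr crossvv scaler0.
exists c => //; apply: contra v0 => /eqP c0; by rewrite vE c0 scale0r.
Qed.

Lemma initial_conditions_plane x : initial_conditions (W := W) x <->
  (forall o, x o != 0) /\ (forall c, c \in initial_equations x -> c = 0).
Proof.
rewrite initial_equationsP; split=> [[/= P0 L0 inc pol]|[x0 [inc pol]]].
  split; first by case.
  split => c cT; first exact/dot_mulmx_tr/inc.
  by apply/proportional_cross => //; apply/proportional1/pol.
split => /= [i|j|c /inc|c /pol] //; first by move/dot_mulmx_tr.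
by move=> cc; apply/proportional1/proportional_cross.
Qed.

Lemma size_enum_map (S : Type) m (f : 'I_m -> S) :
  size [seq f i | i <- enum 'I_m] = m.
Proof. by rewrite size_map size_enum_ord. Qed.

Lemma conclusion_plane x : well_labelled T ->
  initial_conditions (W := W) x -> conclusion_holds (W := W) x ->
  (forall c, c \in final_equations x -> c = 0) /\ discriminant x != 0.
Proof.
move=> wl /initial_conditions_plane[x0 _] concl.
pose P := [seq x (inl i) | i <- enum 'I_(npoints T)].
pose L := [seq x (inr j) | j <- enum 'I_(nlines T)].
have lab : labels_ok (instructions T) (size P) (size L)
    (concl_incident T ++ concl_polar T).
  by rewrite !size_enum_map; exact: wl.
have nz u : u \in P ++ L -> u != 0.
  by rewrite mem_cat => /orP[] /mapP[k _ ->].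
have [] := plane_construct lab nz concl.
rewrite -[construct _ _ _]/(constructed x) => nz0 [/= inc pol].
split; last first.
  rewrite prodf_seq_neq0; apply/allP => u uZ /=.
  by rewrite dot_eq0 nz0.
apply/final_equationsP; split => c cT; first exact/dot_mulmx_tr/inc.
by have [d _ ->] := pol c cT; rewrite mulmx1 crossZr crossvv scaler0.
Qed.

End Plane.

(** * From real coordinates to coordinates in the algebra of a geometry *)

Section Specialization.
Variables (g : geometry) (K : comNzRingType) (s : K).

(** A square root [s] of [j^2] in [K] defines a morphism to [K], by [j = s]. *)
Definition gspec (s2 : s * s = (unit_square g)%:~R) (x : gnumber g K) : K :=
  x.1 + s * x.2.

Hypothesis s2 : s * s = (unit_square g)%:~R.

Fact gspec_is_zmod_morphism : zmod_morphism (gspec s2).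
Proof. by move=> x y; rewrite /gspec /=; ring. Qed.
Fact gspec_is_monoid_morphism : monoid_morphism (gspec s2).
Proof.
split => [|x y]; rewrite /gspec /=; first by rewrite mulr0 addr0.
by rewrite -s2; ring.
Qed.
HB.instance Definition _ :=
  GRing.isZmodMorphism.Build _ _ (gspec s2) gspec_is_zmod_morphism.
HB.instance Definition _ :=
  GRing.isMonoidMorphism.Build _ _ (gspec s2) gspec_is_monoid_morphism.

Lemma gspec_greal c : gspec s2 (greal g c) = c.
Proof. by rewrite /gspec /= mulr0 addr0. Qed.
End Specialization.

Section Localization.
Variables (R : realType) (T : configuration).
Notation W := (plane (1%:M : 'M[R]_3)).
Notation N := #|coordinate W T|.
Notation X := (@generic_point R W T).

Definition geval g (z : object T -> 'rV[gnumber g R]_3) :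
    {rmorphism mpoly N R -> gnumber g R} :=
  mmap (@greal g R) (@coordinates R W T _ z).

Definition reval (x : object T -> 'rV[R]_3) : {rmorphism mpoly N R -> R} :=
  meval (@coordinates R W T _ x).

Lemma geval_generic g (z : object T -> 'rV[gnumber g R]_3) :
  (fun o => map_mx (geval z) (X o)) = z.
Proof. exact: (@map_generic_point R W T _ (@greal g R)). Qed.

Lemma reval_generic (x : object T -> 'rV[R]_3) :
  (fun o => map_mx (reval x) (X o)) = x.
Proof. exact: (@map_generic_point R W T _ idfun). Qed.

Lemma geval_initial g (z : object T -> 'rV[gnumber g R]_3) :
  initial_equations z = map (geval z) (initial_equations X).
Proof. by rewrite -map_initial_equations geval_generic. Qed.
Lemma geval_final g (z : object T -> 'rV[gnumber g R]_3) :
  final_equations z = map (geval z) (final_equations X).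
Proof. by rewrite -map_final_equations geval_generic. Qed.
Lemma geval_discriminant g (z : object T -> 'rV[gnumber g R]_3) :
  discriminant z = geval z (discriminant X).
Proof. by rewrite -map_discriminant geval_generic. Qed.

Lemma reval_initial (x : object T -> 'rV[R]_3) :
  initial_equations x = map (reval x) (initial_equations X).
Proof. by rewrite -map_initial_equations reval_generic. Qed.
Lemma reval_final (x : object T -> 'rV[R]_3) :
  final_equations x = map (reval x) (final_equations X).
Proof. by rewrite -map_final_equations reval_generic. Qed.
Lemma reval_discriminant (x : object T -> 'rV[R]_3) :
  discriminant x = reval x (discriminant X).
Proof. by rewrite -map_discriminant reval_generic. Qed.

Lemma gspec_geval g (s : R) (s2 : s * s = (unit_square g)%:~R)
    (z : object T -> 'rV[gnumber g R]_3) p :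
  gspec s2 (geval z p) = reval (fun o => map_mx (gspec s2) (z o)) p.
Proof.
rewrite /geval /reval /meval mmap_morph; apply: mmap_eq => [c|k] /=.
  exact: gspec_greal.
by rewrite /coordinates mxE.
Qed.

Lemma geval_real g (x : object T -> 'rV[R]_3) p :
  geval (fun o => map_mx (@greal g R) (x o)) p = greal g (reval x p).
Proof.
rewrite /geval /reval /meval (mmap_morph idfun (@greal g R)).
apply: mmap_eq => [c|k] //=.
by rewrite /coordinates mxE.
Qed.

Hypothesis wl : well_labelled T.

(** The form in which the plane theorem is used: among the polynomials that
    define the open set, a single one that does not vanish at [x0] suffices. *)
Definition generically_true (x0 : object T -> 'rV[R]_3) (p : mpoly N R) : Prop :=
  [/\ initial_conditions (W := W) x0, reval x0 p != 0 &
    forall x, initial_conditions (W := W) x -> reval x p != 0 ->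
      conclusion_holds (W := W) x].

(** The plane theorem over the algebra of [g]. The invertibility of the
    discriminant keeps the skewers well defined. *)
Definition transfers g (x0 : object T -> 'rV[R]_3) (h : mpoly N R) : Prop :=
  reval x0 h != 0 /\ 
  forall z : object T -> 'rV[gnumber g R]_3,
    (forall c, c \in initial_equations z -> c = 0) ->
    invertible (geval z h) ->
    (forall c, c \in final_equations z -> c = 0) /\ invertible (discriminant z).

(** The specializations [j = 1] and [j = -1] identify the algebra with R x R, so
    that a configuration over it is a pair of real ones. *)
Lemma transfers_elliptic x0 p : generically_true x0 p ->
  transfers Elliptic x0 (p * discriminant X).
Proof.
move=> [x0i px0 pP]; split.
  rewrite rmorphM mulf_neq0 //.
  have [_] := conclusion_plane wl x0i (pP _ x0i px0).
  by rewrite reval_discriminant.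
move=> z zi; rewrite rmorphM => /invertibleM[pz Dz].
split; last by rewrite geval_discriminant.
have e1 : 1 * 1 = (unit_square Elliptic)%:~R :> R by rewrite mulr1.
have e2 : -1 * -1 = (unit_square Elliptic)%:~R :> R by rewrite mulrNN mulr1.
have spec0 (s : R) (s2 : s * s = (unit_square Elliptic)%:~R) c :
    c \in final_equations z -> gspec s2 c = 0.
  pose x o := map_mx (gspec s2) (z o).
  have inv (q : gnumber Elliptic R) : invertible q -> gspec s2 q != 0.
    case=> d dq; apply/eqP => q0; have := rmorphM (gspec s2) d q.
    by rewrite dq rmorph1 /= q0 mulr0 => /eqP; rewrite oner_eq0.
  have xi : initial_conditions (W := W) x.
    apply/initial_conditions_plane; split => [k|c' ].
      have Dx : invertible (discriminant x).
        apply: invertible_field; rewrite reval_discriminant -gspec_geval.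
        exact: inv.
      have [d] := discriminant_invertible Dx (object_constructed x k).
      move=> dxo; apply/eqP => xo; move/eqP: dxo.
      by rewrite xo dot0l mulr0 eq_sym oner_eq0.
    by rewrite /x map_initial_equations => /mapP[b /zi -> ->]; rewrite rmorph0.
  have px : reval x p != 0 by rewrite -gspec_geval; exact: inv.
  have [xf _] := conclusion_plane wl xi (pP _ xi px).
  move=> cz; apply: xf; rewrite /x map_final_equations; exact: map_f.
move=> [a b] cz; have := spec0 _ e1 _ cz; have := spec0 _ e2 _ cz.
rewrite /gspec /= => ab1 ab2; congr pair; lra.
Qed.

(** The dual numbers encode first-order deformations: a product of two of them
    has the derivative of the product as its infinitesimal part. The equations
    of a configuration at [x0 + j v] are therefore the equations at [x0]
    together with their linearizations. *)
Lemma dual_number_deformation (x0 v : object T -> 'rV[R]_3) :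
  initial_conditions (W := W) x0 ->
  (forall c,
    c \in initial_equations (fun o => gvec Euclidean (x0 o) (v o)) -> c = 0) ->
  infinitesimal_deformation 1%:M x0 v.
Proof.
move=> x0i /initial_equationsP[zinc zpol].
have x0nz := ((initial_conditions_plane x0).1 x0i).1.
split=> c cT.
  have := congr1 snd (zinc c cT); rewrite dot_gvec /= => vc.
  apply/matrixP => i j; rewrite !ord1 [LHS]mxE !mulmx_tr_dot !row1_id [RHS]mxE.
  by rewrite addrC.
have [_ _ _ /(_ c cT)/proportional1[s _ xbE]] := x0i.
have vc : cross (x0 (inl c.1)) (v (inr c.2)) +
    cross (v (inl c.1)) (x0 (inr c.2)) = 0.
  have zc k :=
    congr1 (fun u : 'rV[gnumber Euclidean R]_3 => (u 0 k).2) (zpol c cT).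
  apply: row3P; [have := zc o0|have := zc o1|have := zc o2];
    by rewrite !mxE /= => <-; ring.
(* Since x_b = s x_a, the linearized equation says x_a x (v_b - s v_a) = 0. *)
have [|s' vbE] :=
    @cross_eq0 _ (x0 (inl c.1)) (v (inr c.2) - s *: v (inl c.1)) (x0nz _).
  by rewrite -[RHS]vc xbE; apply: row3P; rewrite /cross !mxE /=; ring.
by exists s, s'; rewrite !mulmx1 -vbE subrK.
Qed.

(** For [I] one takes the polynomials that vanish at all solutions over the
    algebra: this is where [regular_point] leaves the real numbers. Each final
    equation has its own multiplier, and [h] is the product of them all. *)
Lemma transfers_nonsingular g x0 p : generically_true x0 p -> nonsingular 1%:M x0 ->
  exists h, transfers g x0 h.
Proof.
move=> [x0i px0 pP] ns.
have x0e := (initial_conditions_plane x0).1 x0i.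
have [x0f Dx0] := conclusion_plane wl x0i (pP _ x0i px0).
pose I (q : mpoly N R) := forall z : object T -> 'rV[gnumber g R]_3,
  (forall c, c \in initial_equations z -> c = 0) -> geval z q = 0.
have idealI : is_ideal I.
  split=> [z _|q r Iq Ir z zi|q r Ir z zi]; first by rewrite rmorph0.
    by rewrite rmorphD Iq // Ir // addr0.
  by rewrite rmorphM Ir // mulr0.
have I_real q x : I q -> initial_conditions (W := W) x -> reval x q = 0.
  move=> Iq /initial_conditions_plane[_ xe].
  have : geval (fun o => map_mx (@greal g R) (x o)) q = 0.
    apply: Iq => c; rewrite map_initial_equations => /mapP[b /xe -> ->].
    by rewrite rmorph0.
  by rewrite geval_real => -[].
pose x := @coordinates R W T _ x0.
pose r := size (initial_equations X).
pose L (l : 'I_r) := (initial_equations X)`_l.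
have L_in l : L l \in initial_equations X by exact: mem_nth.
have L0 l : reval x0 (L l) = 0.
  by apply: x0e.2; rewrite reval_initial; exact: map_f.
have /choice[Q QE] l : exists q : 'I_N -> mpoly N R,
    L l = \sum_i local_coord x i * q i.
  have [q ->] := first_order_expansion x (L l); exists q.
  by rewrite -/(reval x0 _) L0 mpolyC0 add0r.
have /choice[hF hFP] F : exists h, F \in final_equations X ->
    meval x h = 1 /\ I (h * (p * F)).
  have [FX|] := boolP (F \in final_equations X); last by exists 0.
  suff [h] : exists2 h, meval x h = 1 & I (h * (p * F)) by exists h.
  apply: (regular_point idealI _ QE).
    by move=> l z zi; apply: zi; rewrite geval_initial; exact: map_f.
  move=> v Qv.
  pose vv o : 'rV[R]_3 := \row_k v (enum_rank ((o, (0, k)) : coordinate W T)).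
  have vvE i : coordinates (W := W) vv i = v i.
    rewrite /coordinates mxE -[in RHS](enum_valK i); congr (v (enum_rank _)).
    by case: (enum_val i) => k [a b] /=; rewrite ord1.
  have dvv : infinitesimal_deformation 1%:M x0 vv.
    pose z o := gvec Euclidean (x0 o) (vv o).
    have s2 : 0 * 0 = (unit_square Euclidean)%:~R :> R by rewrite mulr0.
    have zx : (fun o => map_mx (gspec s2) (z o)) = x0.
      apply/funext => o; apply/rowP => k.
      by rewrite !mxE /gspec /= mul0r addr0.
    have zL l : geval z (L l) = 0.
      (* At the dual point x0 + j v, a local coordinate has the value j v_i. *)
      pose eps : gnumber Euclidean R := (0, 1).
      transitivity (greal Euclidean (\sum_i meval x (Q l i) * v i) * eps);
        last first.
        by rewrite Qv rmorph0 mul0r.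
      rewrite QE rmorph_sum /= [RHS]mulrC rmorph_sum mulr_sumr.
      apply: eq_bigr => i _.
      rewrite rmorphM; set q := geval z (Q l i).
      have -> : meval x (Q l i) = q.1.
        rewrite -[LHS]/(reval x0 (Q l i)) -[in LHS]zx -gspec_geval.
        by rewrite /gspec /= mul0r addr0.
      have -> : geval z (local_coord x i) = (0, v i).
        rewrite rmorphB /= mmapX mmap1U mmapC -[v i]vvE /x /coordinates.
        case: (enum_val i) => k [a b] /=; rewrite ord1 /z !mxE.
        by apply: (f_equal2 (@pair R R)); rewrite /= ?subrr ?subr0.
      by rewrite !gnumberM /gmul /eps /greal /=; congr pair; ring.
    have zi : forall c, c \in initial_equations z -> c = 0.
      move=> c; rewrite geval_initial => /mapP[q /(nthP 0)[l ltl <-] ->].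
      exact: (zL (Ordinal ltl)).
    exact: dual_number_deformation.
  have [y [y0 yv yi]] := ns vv dvv.
  pose w t i := t^-1 * (coordinates (W := W) (y t) i - x i).
  exists w; split => [i|q Iq].
    have [dy vy] := yv (enum_val i).1 (enum_val i).2.2.
    rewrite -[v i]vvE /w /x /coordinates; case: (enum_val i) dy vy => k [a b] /=.
    rewrite ord1 => dy vy; rewrite -vy.
    suff -> : (fun t => t^-1 * (y t k 0 b - x0 k 0 b)) =
      (fun h => h^-1 *: (((fun t => y t k 0 b) \o shift 0) (h *: 1) - y 0 k 0 b)).
      exact: dy.
    by apply/funext => t; rewrite y0 /= addr0 /GRing.scale /= mulr1.
  have yi' : \forall t \near 0^', initial_conditions (W := W) (y t).
    exact: nbhs_dnbhs yi.
  near=> t.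
  have t0 : t != 0 by near: t; exact: nbhs_dnbhs_neq.
  have yti : initial_conditions (W := W) (y t) by near: t.
  rewrite (meval_eq (v2 := coordinates (W := W) (y t))) => [|i]; last first.
    by rewrite /w mulrA divff // mul1r addrC subrK.
  rewrite -[LHS]/(reval (y t) q); case: Iq => [Iq|->]; first exact: I_real.
  rewrite rmorphM; have [->|pt] := eqVneq (reval (y t) p) 0; first by rewrite mul0r.
  have [yf _] := conclusion_plane wl yti (pP _ yti pt).
  by rewrite [X in _ * X]yf ?mulr0 // reval_final; exact: map_f.
exists (p * discriminant X * \prod_(F <- final_equations X) hF F); split.
  rewrite !rmorphM !mulf_neq0 //; first by rewrite -reval_discriminant.
  rewrite rmorph_prod prodf_seq_neq0; apply/allP => F /hFP[hF1 _] /=.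
  by rewrite -[X in X != 0]/(meval x (hF F)) hF1 oner_eq0.
move=> z zi; rewrite !rmorphM => /invertibleM[/invertibleM[pz Dz] hz].
split; last by rewrite geval_discriminant.
move=> c; rewrite geval_final => /mapP[F FX ->].
have [_ /(_ z zi)] := hFP F FX; rewrite !rmorphM.
move=> /(invertible_cancel _) hz0; apply: (invertible_cancel pz); apply: hz0.
by move: hz; rewrite rmorph_prod => /invertible_prod; apply.
Unshelve. all: by end_near.
Qed.

End Localization.

Section Normalization.
Variables (g : geometry) (R : realType).
Notation e := ((unit_square g)%:~R : R).
Implicit Types d m : 'rV[R]_3.

Lemma invertible_pair (a b : R) :
  invertible ((a, b) : gnumber g R) <-> a ^+ 2 - e * b ^+ 2 != 0.
Proof. by rewrite -invertible_gnumber. Qed.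

(** In the elliptic case the norm of [z.z] is the product of the squares of the
    real vectors [d + m] and [d - m]; otherwise norms are nonnegative. *)
Lemma gnorm_dot_gt0 d m :
  invertible (dot (gvec g d m) (gvec g d m)) ->
  0 < (dot d d + e * dot m m) ^+ 2 - e * (dot d m + dot m d) ^+ 2.
Proof.
rewrite dot_gvec => /invertible_pair nz; rewrite lt_def nz /=.
have d0 := dot_ge0 d; have m0 := dot_ge0 m.
have := dot_ge0 (d - m); have := dot_ge0 (d + m).
rewrite !dotBl !dotBr !dotDl !dotDr (dotC m d) => p1 p2.
case: g {nz} => /=; rewrite ?mulrN1z ?mulr0z.
- rewrite mulr1z !mul1r; have := mulr_ge0 p1 p2; nra.
- by rewrite !mul0r subr0 sqr_ge0.
- by rewrite !mulN1r opprK addr_ge0 ?sqr_ge0.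
Qed.

(** Pluecker coordinates satisfy [d.m = 0], which says that [z.z] is real. If
    [z.z = a + j b] has the norm [s^2], the factor [a + s - j b] makes it real:
    it is, up to a real factor, the inverse of a square root of [z.z]. *)
Lemma orthogonal_representative (n : 'rV[gnumber g R]_3) :
  invertible (dot n n) ->
  exists d m, [/\ similar n (gvec g d m), dot d m = 0 & dot d d + e * dot m m != 0].
Proof.
have [d [m ->]] := gvecP n => ni.
have := gnorm_dot_gt0 ni; move: (ni); rewrite dot_gvec => /invertible_pair.
set a := _ + e * _; set b := dot d m + _ => N0 Npos.
have [c ci im] : exists2 c : gnumber g R, invertible c &
    (c * c * (a, b)).2 = 0.
  have [b0|b0] := eqVneq b 0.
    by exists 1; [exact: invertible1|rewrite b0 !mul1r].
  pose s := Num.sqrt (a ^+ 2 - e * b ^+ 2).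
  have s2 : s ^+ 2 = a ^+ 2 - e * b ^+ 2 by rewrite sqr_sqrtr // ltW.
  have s0 : 0 < s by rewrite sqrtr_gt0.
  exists (a + s, - b); last first.
    rewrite !gnumberM /gmul /=.
    transitivity (b * (s ^+ 2 - (a ^+ 2 - e * b ^+ 2))); first by ring.
    by rewrite s2 subrr mulr0.
  apply/invertible_pair.
  have -> : (a + s) ^+ 2 - e * (- b) ^+ 2 =
      2 * s * (s + a) + (a ^+ 2 - e * b ^+ 2 - s ^+ 2) by ring.
  rewrite s2 subrr addr0; apply: mulf_neq0.
    by rewrite mulf_neq0 ?pnatr_eq0 ?gt_eqF.
  (* The factor is a unit unless s = -a; then e = 0, as b is not 0, and a = d.d
     would be negative. *)
  apply/eqP => sa; have sE : s = - a by rewrite -[RHS]add0r -sa addrK.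
  have /eqP : e * b ^+ 2 = 0.
    by apply: (addrI (s ^+ 2)); rewrite addr0 {1}s2 subrK sE sqrrN.
  rewrite mulf_eq0 sqrf_eq0 (negbTE b0) orbF => /eqP e0.
  have := s0; rewrite sE oppr_gt0 ltNge => /negP; apply.
  by rewrite /a e0 mul0r addr0 dot_ge0.
have simn : similar (gvec g d m) (c *: gvec g d m) by exists c.
move: simn; have [d' [m' nE]] := gvecP (c *: gvec g d m); rewrite nE => simn.
exists d', m'; have := (invertible_similar simn).1 ni.
have dm0 : (dot (gvec g d' m') (gvec g d' m')).2 = 0.
  by rewrite -nE dotZl dotZr dot_gvec mulrA.
have {}dm0 : dot d' m' = 0 by move: dm0; rewrite dot_gvec /= (dotC m'); lra.
rewrite dot_gvec (dotC m') dm0 addr0 => /invertible_pair.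
rewrite expr0n mulr0 subr0 sqrf_eq0.
by [].
Qed.
End Normalization.

(** * Pluecker coordinates *)

Local Notation h0 := (@Ordinal 4 0 isT).
Local Notation h1 := (@Ordinal 4 1 isT).
Local Notation h2 := (@Ordinal 4 2 isT).
Local Notation h3 := (@Ordinal 4 3 isT).

Lemma ord4P (P : 'I_4 -> Prop) : P h0 -> P h1 -> P h2 -> P h3 -> forall k, P k.
Proof.
move=> P0 P1 P2 P3 [[|[|[|[|//]]]] lt4]; [move: P0|move: P1|move: P2|move: P3];
  by congr P; apply: val_inj.
Qed.

Lemma row4P (K : Type) (u v : 'rV[K]_4) : u 0 h0 = v 0 h0 -> u 0 h1 = v 0 h1 ->
  u 0 h2 = v 0 h2 -> u 0 h3 = v 0 h3 -> u = v.
Proof. by move=> e0 e1 e2 e3; apply/rowP; apply: ord4P. Qed.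

(** A point of R^4 is [(u, t)] with [u] in R^3; at [t = 1] this is the affine
    chart in which the direction and the moment of a line are the usual ones. *)
Definition spatial (K : Type) (u : 'rV[K]_4) : 'rV[K]_3 :=
  vec3 (u 0 h0) (u 0 h1) (u 0 h2).

Definition affine (K : Type) (u : 'rV[K]_3) (t : K) : 'rV[K]_4 :=
  \row_k match val k with
         | 0%N => u 0 o0 | 1%N => u 0 o1 | 2%N => u 0 o2 | _ => t end.

Section Pluecker.
Variable K : comNzRingType.
Implicit Types p q : 'rV[K]_4.

Definition direction p q : 'rV[K]_3 := p 0 h3 *: spatial q - q 0 h3 *: spatial p.
Definition moment p q : 'rV[K]_3 := cross (spatial p) (spatial q).

Definition plucker (g : geometry) (L : 'M[K]_(2, 4)) : 'rV[gnumber g K]_3 :=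
  gvec g (direction (row 0 L) (row 1 L)) (moment (row 0 L) (row 1 L)).
End Pluecker.

Lemma map_plucker (g : geometry) (K S : comNzRingType) (f : {rmorphism K -> S})
    (L : 'M[K]_(2, 4)) :
  plucker g (map_mx f L) = map_mx (gmap f) (plucker g L).
Proof.
apply/rowP; apply: ord3P; rewrite /plucker /direction /moment !mxE /gmap /=;
  by rewrite !rmorphB !rmorphM.
Qed.

Ltac row_ring := rewrite /dot /direction /moment /spatial /cross ?mxE /=; ring.

Section RealPluecker.
Variable R : realType.
Implicit Types (p q u v : 'rV[R]_4) (d m : 'rV[R]_3) (L M : 'M[R]_(2, 4)).

Notation dir L := (direction (row 0 L) (row 1 L)).
Notation mom L := (moment (row 0 L) (row 1 L)).

Lemma direction_moment p q : dot (direction p q) (moment p q) = 0.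
Proof. row_ring. Qed.

Lemma mul2E (B : 'rV[R]_2) L : B *m L = B 0 0 *: row 0 L + B 0 1 *: row 1 L.
Proof.
rewrite mulmx_sum_row !big_ord_recl big_ord0 addr0.
by congr (_ + B 0 _ *: row _ L); apply: val_inj.
Qed.

Lemma direction_comb a b a' b' p q :
  direction (a *: p + b *: q) (a' *: p + b' *: q) =
  (a * b' - b * a') *: direction p q.
Proof. by apply: row3P; row_ring. Qed.

Lemma moment_comb a b a' b' p q :
  moment (a *: p + b *: q) (a' *: p + b' *: q) =
  (a * b' - b * a') *: moment p q.
Proof. by apply: row3P; row_ring. Qed.

(** The equations, linear in [u], which say that [u] is on the line with
    direction [d] and moment [m]. *)
Definition on_line u d m : Prop :=
  u 0 h3 *: m = cross (spatial u) d /\ dot (spatial u) m = 0.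

Lemma on_lineZ u d m c : c != 0 -> on_line u (c *: d) (c *: m) <-> on_line u d m.
Proof.
move=> c0; rewrite /on_line crossZr dotZr scalerA mulrC -scalerA; split=> -[e1 e2].
  split; first exact: (scalerI c0).
  by apply/eqP; move/eqP: e2; rewrite mulf_eq0 (negbTE c0).
by rewrite e1 e2 mulr0.
Qed.

Lemma sub_on_line L u : (u <= L)%MS -> on_line u (dir L) (mom L).
Proof.
case/submxP => B ->; rewrite mul2E; split; last by row_ring.
by apply: row3P; row_ring.
Qed.

Lemma row_free_plucker L : row_free L <-> ~ (dir L = 0 /\ mom L = 0).
Proof.
split=> [free [d0 m0]|nz].
  have kerL (B : 'rV_2) : B *m L = 0 -> B = 0.
    by move=> BL; apply: (row_free_inj free); rewrite mul0mx.
  have minor k : L 0 k = 0.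
    pose B : 'rV[R]_2 := \row_j (if j == 0 then - L 1 k else L 0 k).
    suff /kerL B0 : B *m L = 0.
      by have := congr1 (fun w : 'rV[R]_2 => w 0 1) B0; rewrite !mxE.
    have zd l := congr1 (fun w : 'rV[R]_3 => w 0 l) d0.
    have zm l := congr1 (fun w : 'rV[R]_3 => w 0 l) m0.
    rewrite mul2E !mxE /=.
    move: (zd o0) (zd o1) (zd o2) (zm o0) (zm o1) (zm o2).
    rewrite /direction /moment /cross /spatial !mxE /= => z0 z1 z2 z3 z4 z5.
    by move: k @B; apply: ord4P => B; apply: row4P; rewrite !mxE /=; lra.
  have /kerL B0 : (delta_mx 0 0 : 'rV[R]_2) *m L = 0.
    by rewrite -rowE; apply/rowP => k; rewrite !mxE minor.
  have /eqP := congr1 (fun w : 'rV[R]_2 => w 0 0) B0.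
  by rewrite !mxE eqxx oner_eq0.
apply: inj_row_free => B; rewrite mul2E => BL.
apply/eqP; apply/negPn/negP => B0; apply: nz.
have [dl dr] : B 0 0 *: dir L = 0 /\ B 0 1 *: dir L = 0.
  have := direction_comb (B 0 0) (B 0 1) 0 1 (row 0 L) (row 1 L).
  have := direction_comb 1 0 (B 0 0) (B 0 1) (row 0 L) (row 1 L).
  rewrite BL mulr1 mulr0 mul0r mul1r !subr0 => <- <-.
  by split; apply: row3P; row_ring.
have [ml mr] : B 0 0 *: mom L = 0 /\ B 0 1 *: mom L = 0.
  have := moment_comb (B 0 0) (B 0 1) 0 1 (row 0 L) (row 1 L).
  have := moment_comb 1 0 (B 0 0) (B 0 1) (row 0 L) (row 1 L).
  rewrite BL mulr1 mulr0 mul0r mul1r !subr0 => <- <-.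
  by split; apply: row3P; row_ring.
have [c c0 [cd cm]] : exists2 c, c != 0 & c *: dir L = 0 /\ c *: mom L = 0.
  have [B00|] := eqVneq (B 0 0) 0; last by exists (B 0 0).
  have [B01|] := eqVneq (B 0 1) 0; last by exists (B 0 1).
  case/eqP: B0; apply/rowP => -[[|[|//]] lt2]; rewrite !mxE;
    [rewrite -[RHS]B00|rewrite -[RHS]B01]; by congr (B 0 _); apply: val_inj.
by split; apply: (scalerI c0); rewrite ?cd ?cm scaler0.
Qed.

(** Cramer's rule: a minor of [L], multiplied by [u], is a combination of the
    rows of [L] modulo the equations [on_line], which are 3 x 3 minors. If all
    minors vanish, then so do the Pluecker coordinates. *)
Lemma on_line_sub L u : row_free L -> on_line u (dir L) (mom L) -> (u <= L)%MS.
Proof.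
move=> /row_free_plucker nz [/rowP e1 e2].
move: (e1 o0) (e1 o1) (e1 o2) e2.
rewrite /direction /moment /cross /dot /spatial !mxE /= => x0 x1 x2 x3.
have sub c a b : c != 0 -> c *: u = a *: row 0 L + b *: row 1 L -> (u <= L)%MS.
  move=> c0 uE; rewrite -(eqmx_scale u c0) uE.
  by rewrite addmx_sub // scalemx_sub // row_sub.
pose minor k l := L 0 k * L 1 l - L 0 l * L 1 k.
have cramer k l : (forall j, minor k l * u 0 j =
    (u 0 k * L 1 l - u 0 l * L 1 k) * L 0 j +
    (L 0 k * u 0 l - L 0 l * u 0 k) * L 1 j) ->
  minor k l != 0 -> (u <= L)%MS.
  move=> E /sub; apply; apply/rowP => j; rewrite !mxE; exact: E.
apply: contrapT => nsub; apply: nz.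
have z k l : (forall j, minor k l * u 0 j =
    (u 0 k * L 1 l - u 0 l * L 1 k) * L 0 j +
    (L 0 k * u 0 l - L 0 l * u 0 k) * L 1 j) ->
  minor k l = 0.
  by move=> E; apply: contrapT => /eqP nzm; apply: nsub; apply: cramer E nzm.
have m01 : minor h0 h1 = 0 by apply: z; apply: ord4P; rewrite /minor; lra.
have m02 : minor h0 h2 = 0 by apply: z; apply: ord4P; rewrite /minor; lra.
have m12 : minor h1 h2 = 0 by apply: z; apply: ord4P; rewrite /minor; lra.
have m03 : minor h0 h3 = 0 by apply: z; apply: ord4P; rewrite /minor; lra.
have m13 : minor h1 h3 = 0 by apply: z; apply: ord4P; rewrite /minor; lra.
have m23 : minor h2 h3 = 0 by apply: z; apply: ord4P; rewrite /minor; lra.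
rewrite /minor in m01 m02 m12 m03 m13 m23.
by split; apply: row3P; rewrite /direction /moment /cross /spatial !mxE /=; lra.
Qed.

Lemma eqmx_plucker L M : row_free L -> row_free M ->
  (L :=: M)%MS <-> exists2 c, c != 0 & dir M = c *: dir L /\ mom M = c *: mom L.
Proof.
move=> freeL freeM; split => [LM|[c c0 [dE mE]]].
  have /submxP[B MB] : (M <= L)%MS by rewrite LM.
  have rE i : row i M = B i 0 *: row 0 L + B i 1 *: row 1 L.
    by rewrite MB row_mul mul2E !mxE.
  have dE : dir M = (B 0 0 * B 1 1 - B 0 1 * B 1 0) *: dir L.
    by rewrite !rE direction_comb.
  have mE : mom M = (B 0 0 * B 1 1 - B 0 1 * B 1 0) *: mom L.
    by rewrite !rE moment_comb.
  exists (B 0 0 * B 1 1 - B 0 1 * B 1 0) => //; apply/eqP => c0.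
  by move: freeM => /row_free_plucker[]; rewrite dE mE c0 !scale0r.
apply/eqmxP/andP; split; apply/row_subP => i.
  apply: on_line_sub => //; rewrite dE mE; apply/on_lineZ => //.
  exact/sub_on_line/row_sub.
apply: on_line_sub => //; apply/(on_lineZ _ _ _ c0); rewrite -dE -mE.
exact/sub_on_line/row_sub.
Qed.

Definition rows2 p q : 'M[R]_(2, 4) := col_mx p q.

Lemma row0_rows2 p q : row 0 (rows2 p q) = p.
Proof.
rewrite -[RHS](row_id 0) -(rowKu 0 p q); congr (row _ _); exact: val_inj.
Qed.

Lemma row1_rows2 p q : row 1 (rows2 p q) = q.
Proof.
rewrite -[RHS](row_id 0) -(rowKd 0 p q); congr (row _ _); exact: val_inj.
Qed.
End RealPluecker.

(** * Intersection at right angle in elliptic and hyperbolic space *)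

Local Notation form := Defs.form.

Lemma det4 (R : comNzRingType) (a : nat -> nat -> R) :
  \det (\matrix_(i < 4, j < 4) a i j) =
  (a 0 0 * a 1 1 - a 0 1 * a 1 0) * (a 2 2 * a 3 3 - a 2 3 * a 3 2)
 - (a 0 0 * a 1 2 - a 0 2 * a 1 0) * (a 2 1 * a 3 3 - a 2 3 * a 3 1)
 + (a 0 0 * a 1 3 - a 0 3 * a 1 0) * (a 2 1 * a 3 2 - a 2 2 * a 3 1)
 + (a 0 1 * a 1 2 - a 0 2 * a 1 1) * (a 2 0 * a 3 3 - a 2 3 * a 3 0)
 - (a 0 1 * a 1 3 - a 0 3 * a 1 1) * (a 2 0 * a 3 2 - a 2 2 * a 3 0)
 + (a 0 2 * a 1 3 - a 0 3 * a 1 2) * (a 2 0 * a 3 1 - a 2 1 * a 3 0) :> R.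
Proof.
rewrite (expand_det_row _ ord0) !big_ord_recl big_ord0 /cofactor.
rewrite !(expand_det_row _ ord0) !big_ord_recl !big_ord0 /cofactor.
rewrite !(expand_det_row _ ord0) !big_ord_recl !big_ord0 /cofactor !det_mx11.
by rewrite !mxE /= /bump /=; ring.
Qed.

Section TwoPlanes.
Variable R : realType.
Implicit Types (p q r u v : 'rV[R]_4) (d m : 'rV[R]_3) (L M : 'M[R]_(2, 4)).

Notation dir L := (direction (row 0 L) (row 1 L)).
Notation mom L := (moment (row 0 L) (row 1 L)).

Lemma formE (e : R) p q :
  form e p q = dot (spatial p) (spatial q) + e * (p 0 h3 * q 0 h3).
Proof.
have -> : h3 = ord_max by apply: val_inj.
rewrite /form big_mkcond !big_ord_recl big_ord0 /= /dot /spatial !mxE /=.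
rewrite !addr0 addrA.
by congr (_ * _ + _ * _ + _ * _ + _); congr (_ 0 _); apply: val_inj.
Qed.

Ltac form_ring :=
  rewrite !formE /dot /direction /moment /spatial /cross ?mxE /=; ring.

Lemma formC e p q : form e p q = form e q p. Proof. form_ring. Qed.
Lemma formBr e p q r : form e p (q - r) = form e p q - form e p r.
Proof. form_ring. Qed.
Lemma formBl e p q r : form e (q - r) p = form e q p - form e r p.
Proof. form_ring. Qed.
Lemma formZr e p q (a : R) : form e p (a *: q) = a * form e p q.
Proof. form_ring. Qed.
Lemma formZl e p q (a : R) : form e (a *: q) p = a * form e q p.
Proof. form_ring. Qed.

(** The inner product of two bivectors with the common factor [p]. When
    [e^2 = 1], it is [e] times the real part of the dot product of the
    corresponding vectors over the algebra. *)
Lemma gram (e : R) p q r :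
  form e p p * form e q r - form e p q * form e p r =
  e * dot (direction p q) (direction p r) + dot (moment p q) (moment p r).
Proof. form_ring. Qed.

Lemma coplanar p q r :
  dot (direction p q) (moment p r) + dot (moment p q) (direction p r) = 0.
Proof. rewrite /dot /direction /moment /spatial /cross !mxE /=; ring. Qed.

Lemma row_free_rows2 p q : p != 0 -> ~~ (q <= p)%MS -> row_free (rows2 p q).
Proof.
move=> p0 qp; apply: inj_row_free => B; rewrite mul2E row0_rows2 row1_rows2 => BL.
have [B1|B1] := eqVneq (B 0 1) 0; last first.
  case/negP: qp; rewrite -(eqmx_scale q B1).
  have -> : B 0 1 *: q = - (B 0 0 *: p) by apply/eqP; rewrite -addr_eq0 addrC BL.
  by rewrite -scaleNr scalemx_sub.
move: BL; rewrite B1 scale0r addr0 => /eqP; rewrite scaler_eq0 (negbTE p0) orbF.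
move=> /eqP B0; apply/rowP => -[[|[|//]] lt2]; rewrite !mxE;
  [rewrite -[RHS]B0|rewrite -[RHS]B1]; by congr (B 0 _); apply: val_inj.
Qed.

Lemma row2_sub L M : (row 0 L <= M)%MS -> (row 1 L <= M)%MS -> (L <= M)%MS.
Proof.
move=> L0 L1; apply/row_subP => -[[|[|//]] lt2]; [move: L0|move: L1];
  by congr (row _ L <= M)%MS; apply: val_inj.
Qed.

Lemma eqmx_rows2 L p q : row_free L -> row_free (rows2 p q) ->
  (p <= L)%MS -> (q <= L)%MS -> (L :=: rows2 p q)%MS.
Proof.
move=> freeL freepq pL qL; apply/eqmxP; rewrite andbC.
have sub : (rows2 p q <= L)%MS by apply: row2_sub; rewrite ?row0_rows2 ?row1_rows2.
rewrite sub /= -(geq_leqif (mxrank_leqif_sup sub)).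
by rewrite (eqP freeL) (eqP freepq).
Qed.

Lemma second_vector L p : row_free L ->
  exists2 q : 'rV[R]_4, (q <= L)%MS & ~~ (q <= p)%MS.
Proof.
move=> freeL; have : ~~ (L <= p)%MS.
  apply/negP => /mxrankS; rewrite (eqP freeL) => le2.
  by have := leq_trans le2 (rank_leq_row p).
by case/row_subPn => i nsub; exists (row i L); first exact: row_sub.
Qed.

Lemma orthogonal_basis (e : R) L p : row_free L -> (p <= L)%MS -> form e p p != 0 ->
  exists2 u, form e p u = 0 & (L :=: rows2 p u)%MS.
Proof.
move=> freeL pL pp; have [q qL qp] := second_vector p freeL.
pose u := form e p p *: q - form e p q *: p.
exists u; first by rewrite /u formBr !formZr; ring.
have p0 : p != 0.
  by apply: contraNneq pp => ->; apply/eqP; form_ring.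
have up : ~~ (u <= p)%MS.
  apply: contra qp => up; rewrite -(eqmx_scale q pp).
  have -> : form e p p *: q = u + form e p q *: p by rewrite subrK.
  by rewrite addmx_sub // scalemx_sub.
apply: eqmx_rows2 => //; first exact: row_free_rows2.
by rewrite /u addmx_sub ?eqmx_opp ?scalemx_sub.
Qed.

(** Coplanarity is the vanishing of the determinant of the four rows, expanded
    along the rows of [L]; a relation between the rows yields a common point. *)
Lemma common_vector L M : row_free L -> row_free M ->
  dot (dir L) (mom M) + dot (mom L) (dir M) = 0 ->
  exists p, [/\ p != 0, (p <= L)%MS & (p <= M)%MS].
Proof.
move=> freeL freeM LM.
pose a (i j : nat) : R := match i with
  | 0 => L 0 (inord j) | 1 => L 1 (inord j)
  | 2 => M 0 (inord j) | _ => M 1 (inord j) end.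
have inordE : [/\ inord 0 = h0, inord 1 = h1, inord 2 = h2 & inord 3 = h3].
  by split; apply: val_inj; rewrite /= inordK.
pose A : 'M[R]_4 := \matrix_(i, j) a i j.
have AE : A = col_mx L M.
  apply/matrixP => -[[|[|[|[|//]]]] lt4] j; rewrite !mxE /= /a inord_val;
   case: splitP => // -[[|[|//]] lt2] //= _; congr (_ _ j); exact: val_inj.
have /eqP/det0P[w w0 wA] : \det A = 0.
  have [i0 i1 i2 i3] := inordE.
  rewrite det4 /a i0 i1 i2 i3 -[RHS]oppr0 -LM.
  rewrite /dot /direction /moment /spatial /cross !mxE /=; ring.
pose w' : 'rV[R]_(2 + 2) := w.
have : lsubmx w' *m L + rsubmx w' *m M = 0.
  by rewrite -mul_row_col hsubmxK -AE.
move=> wLM; exists (lsubmx w' *m L); split; last 2 first.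
- exact: submxMl.
- rewrite (_ : _ *m L = - rsubmx w' *m M) ?submxMl // mulNmx.
  by apply/eqP; rewrite -addr_eq0 wLM.
apply: contra w0 => /eqP wL0.
have z1 : lsubmx w' = 0 by apply: (row_free_inj freeL); rewrite mul0mx.
have z2 : rsubmx w' = 0.
  by apply: (row_free_inj freeM); rewrite mul0mx -wLM wL0 add0r.
by rewrite -[w]/w' -[w']hsubmxK z1 z2 row_mx0.
Qed.

Lemma free_eqmx L M : (L :=: M)%MS -> row_free L -> row_free M.
Proof. by move=> LM /eqP fL; apply/eqP; rewrite -LM. Qed.

Lemma right_angle_equations (e : R) (point : 'rV[R]_4 -> Prop) L M :
  e * e = 1 -> row_free L -> row_free M -> two_plane_right_angle e point L M ->
  dot (dir L) (dir M) + e * dot (mom L) (mom M) = 0 /\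
  dot (dir L) (mom M) + dot (mom L) (dir M) = 0.
Proof.
move=> e2 freeL freeM [p [u [v [_ [pu pv] LE ME uv]]]].
have eqL : (rows2 p u :=: L)%MS by apply: eqmx_sym.
have eqM : (rows2 p v :=: M)%MS by apply: eqmx_sym.
have [c _] := (eqmx_plucker (free_eqmx LE freeL) freeL).1 eqL.
have [c' _] := (eqmx_plucker (free_eqmx ME freeM) freeM).1 eqM.
rewrite !row0_rows2 !row1_rows2 => -[-> ->] [-> ->].
rewrite !dotZl !dotZr; have g := gram e p u v; have k := coplanar p u v.
rewrite pu pv uv mulr0 mul0r subrr in g.
split; last by rewrite !mulrA [_ * c']mulrC -!mulrA -!mulrDr k !mulr0.
transitivity (c' * c * (e * (e * dot (direction p u) (direction p v) +
    dot (moment p u) (moment p v)) +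
    (1 - e * e) * dot (direction p u) (direction p v))); first by ring.
by rewrite -g e2 subrr mul0r mulr0 addr0 mulr0.
Qed.

(** At a common point [p] which is not isotropic, both lines have directions [u]
    and [v] orthogonal to [p], and then [dot] computes [form e u v] up to the
    nonzero factor [form e p p]. *)
Lemma right_angle_at (e : R) (point : 'rV[R]_4 -> Prop) L M p :
  e * e = 1 -> row_free L -> row_free M -> point p -> form e p p != 0 ->
  (p <= L)%MS -> (p <= M)%MS ->
  dot (dir L) (dir M) + e * dot (mom L) (mom M) = 0 ->
  two_plane_right_angle e point L M.
Proof.
move=> e2 freeL freeM pt pp pL pM LM.
have [u pu LE] := orthogonal_basis freeL pL pp.
have [v pv ME] := orthogonal_basis freeM pM pp.
exists p, u, v; split => //.
have [c c0] := (eqmx_plucker freeL (free_eqmx LE freeL)).1 LE.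
have [c' c'0] := (eqmx_plucker freeM (free_eqmx ME freeM)).1 ME.
rewrite !row0_rows2 !row1_rows2 => -[dL mL] [dM mM].
have := gram e p u v; rewrite pu pv mul0r subr0 dL mL dM mM !dotZl !dotZr.
move=> E; have /eqP : form e p p * form e u v = 0.
  rewrite E.
  transitivity (c * c' * (e * (dot (dir L) (dir M) + e * dot (mom L) (mom M)) +
    (1 - e * e) * dot (mom L) (mom M))); first by ring.
  by rewrite LM e2 subrr mul0r mulr0 addr0 mulr0.
by rewrite mulf_eq0 (negbTE pp) => /eqP.
Qed.

End TwoPlanes.

(** * Lines in elliptic space *)

(** The dictionary between lines and vectors over the algebra of [g]. The last
    clause provides the lines that correspond to the points of the real plane;
    as [transfers] is not a homogeneous condition, they are required to have
    prescribed coordinates rather than similar ones. *)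
Definition coordinatizes (R : realType) (g : geometry) (r c : nat)
    (line : 'M[R]_(r, c) -> Prop)
    (same right_angle : 'M[R]_(r, c) -> 'M[R]_(r, c) -> Prop)
    (psi : 'M[R]_(r, c) -> 'rV[gnumber g R]_3) : Prop :=
  [/\ forall L, line L -> invertible (dot (psi L) (psi L)),
      forall L M, line L -> line M -> right_angle L M <-> dot (psi L) (psi M) = 0,
      forall L M, line L -> line M -> same L M <-> similar (psi L) (psi M),
      forall n, invertible (dot n n) -> exists2 L, line L & similar n (psi L)
    & forall u : 'rV[R]_3, u != 0 ->
        exists2 L, line L & psi L = map_mx (@greal g R) u].

Section Construction.
Variable R : realType.
Implicit Types (p q r u v : 'rV[R]_4) (d m : 'rV[R]_3) (L M : 'M[R]_(2, 4)).

Notation dir L := (direction (row 0 L) (row 1 L)).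
Notation mom L := (moment (row 0 L) (row 1 L)).

Lemma lagrange d m : dot d d * dot m m = dot d m ^+ 2 + dot (cross d m) (cross d m).
Proof. rewrite /dot /cross !mxE /=; ring. Qed.

(** The point of the line [(d, m)] which is nearest to the origin. *)
Definition foot d m : 'rV[R]_3 := (dot d d)^-1 *: cross d m.

Lemma cross_foot d m : d != 0 -> dot d m = 0 -> cross (foot d m) d = m.
Proof.
rewrite -dot_eq0 => d0 dm.
have -> : cross (foot d m) d = - ((dot d d)^-1 *: cross d (cross d m)).
  by rewrite /foot; apply: row3P; rewrite /cross !mxE /=; ring.
by rewrite cross_cross dm scale0r sub0r scalerN opprK scalerA mulVf ?scale1r.
Qed.

Lemma dot_foot d m : d != 0 -> dot d m = 0 ->
  dot (foot d m) (foot d m) = dot m m / dot d d.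
Proof.
rewrite -dot_eq0 => d0 dm; have := lagrange d m; rewrite dm expr0n add0r => E.
by rewrite /foot dotZl dotZr -E; field.
Qed.

Lemma spatial_affine (K : Type) (u : 'rV[K]_3) t : spatial (affine u t) = u.
Proof. by apply/rowP; apply: ord3P; rewrite !mxE. Qed.

Lemma affine3 (K : Type) (u : 'rV[K]_3) t : affine u t 0 h3 = t.
Proof. by rewrite mxE. Qed.

Lemma exists_orthogonal m : exists2 x : 'rV[R]_3, x != 0 & dot m x = 0.
Proof.
have vec_neq0 (a b c : R) : vec3 a b c = 0 -> [/\ a = 0, b = 0 & c = 0].
  by move=> v0; split;
    [have := congr1 (fun w : 'rV[R]_3 => w 0 o0) v0
    |have := congr1 (fun w : 'rV[R]_3 => w 0 o1) v0
    |have := congr1 (fun w : 'rV[R]_3 => w 0 o2) v0]; rewrite !mxE.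
have [x0|x0] := eqVneq (vec3 (m 0 o1) (- m 0 o0) 0) 0; last first.
  by exists (vec3 (m 0 o1) (- m 0 o0) 0) => //; rewrite /dot !mxE /=; ring.
have [m1 /eqP m0 _] := vec_neq0 _ _ _ x0; rewrite oppr_eq0 in m0.
exists (vec3 1 0 0); last by rewrite /dot !mxE /= m1 (eqP m0); ring.
by apply/eqP => /vec_neq0[/eqP]; rewrite oner_eq0.
Qed.

Lemma exists_affine_plucker d m : d != 0 -> dot d m = 0 ->
  exists L, [/\ row_free L, dir L = d, mom L = m & (affine (foot d m) 1 <= L)%MS].
Proof.
move=> d0 dm; exists (rows2 (affine (foot d m) 1) (affine d 0)).
have dE : dir (rows2 (affine (foot d m) 1) (affine d 0)) = d.
  rewrite row0_rows2 row1_rows2 /direction !affine3 !spatial_affine.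
  by rewrite scale1r scale0r subr0.
split => //; last by rewrite -[X in (X <= _)%MS](row0_rows2 _ (affine d 0)) row_sub.
  by apply/row_free_plucker; rewrite dE => -[dz _]; rewrite dz eqxx in d0.
by rewrite row0_rows2 row1_rows2 /moment !spatial_affine cross_foot.
Qed.

(** Lines at infinity ([d = 0]) need a separate construction: the plane
    orthogonal to [m] is spanned by [x] and [m x x]. *)
Lemma exists_plucker d m : ~ (d = 0 /\ m = 0) -> dot d m = 0 ->
  exists L, [/\ row_free L, dir L = d & mom L = m].
Proof.
move=> nz dm; have [d0|d0] := eqVneq d 0; last first.
  by have [L [? ? ? _]] := exists_affine_plucker d0 dm; exists L.
have [x x0 mx] := exists_orthogonal m.
pose L := rows2 (affine ((dot x x)^-1 *: x) 0) (affine (cross m x) 0).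
have dE : dir L = d.
  by rewrite row0_rows2 row1_rows2 /direction !affine3 !scale0r subr0 d0.
have mE : mom L = m.
  rewrite row0_rows2 row1_rows2 /moment !spatial_affine crossZl cross_cross.
  by rewrite dotC in mx; rewrite mx scale0r subr0 scalerA mulVf ?dot_eq0 // scale1r.
by exists L; split => //; apply/row_free_plucker; rewrite dE mE.
Qed.

Lemma similar_gvec_real g (c : R) d m : c != 0 ->
  similar (gvec g d m) (gvec g (c *: d) (c *: m)).
Proof.
move=> c0; exists ((c, 0) : gnumber g R).
  by apply/invertible_pair; rewrite expr0n mulr0 subr0 sqrf_eq0.
by rewrite scale_gvec mulr0 !scale0r !addr0.
Qed.

Lemma eqmx_similar g L M : row_free L -> row_free M -> (L :=: M)%MS ->
  similar (plucker g L) (plucker g M).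
Proof.
move=> freeL freeM /eqmx_plucker[] // c c0 [dM mM].
by rewrite /plucker dM mM; apply: similar_gvec_real.
Qed.

Lemma dot_plucker_eq0 g L M : dot (plucker g L) (plucker g M) = 0 <->
  dot (dir L) (dir M) + (unit_square g)%:~R * dot (mom L) (mom M) = 0 /\
  dot (dir L) (mom M) + dot (mom L) (dir M) = 0.
Proof. by rewrite dot_gvec; split => [[]|[-> ->]]. Qed.

Lemma elliptic_lineP L : two_plane_line (@elliptic_point R) L <-> row_free L.
Proof.
split => [[]//|free]; split => //; exists (row 0 L); last exact: row_sub.
apply/eqP => L0; have /row_free_plucker := free; apply.
by rewrite /direction /moment L0; split; apply: row3P;
  rewrite /spatial /cross !mxE /=; ring.
Qed.

Lemma mulmx_tr_form L M i j : (L *m M^T) i j = form 1 (row i L) (row j M).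
Proof.
rewrite formE mul1r !mxE !big_ord_recl big_ord0 addr0 /dot /spatial !mxE /= !addrA.
by congr (_ * _ + _ * _ + _ * _ + _ * _); congr (_ _ _); apply: val_inj.
Qed.

(** Exchanging direction and moment yields the dual line. *)
Lemma on_line_dual p r d m : ~ (d = 0 /\ m = 0) ->
  on_line p d m -> on_line r m d -> form 1 p r = 0.
Proof.
move=> nz [p1 p2] [r1 r2]; rewrite formE mul1r; set s := _ + _.
have sd : s *: d = 0.
  rewrite /s scalerDl -scalerA r1 -crossZr p1 cross_cross r2 scale0r sub0r.
  by rewrite dotC subrr.
have sm : s *: m = 0.
  rewrite /s scalerDl [p 0 h3 * _]mulrC -scalerA p1 -crossZr r1 cross_cross.
  by rewrite p2 scale0r sub0r subrr.
apply/eqP; apply: contraT => s0; case: nz.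
by split; apply: (scalerI s0); rewrite ?sd ?sm scaler0.
Qed.

(** If [z.z] and [c^2 z.z] are both real, with [z.z] nonzero, then [c = a + j b]
    is real or a multiple of [j]. *)
Lemma orthogonal_multiple (e a b : R) d m : dot d m = 0 ->
  dot (a *: d + (e * b) *: m) (a *: m + b *: d) = 0 ->
  a * b * (dot d d + e * dot m m) = 0.
Proof.
rewrite !(dotDl, dotDr, dotZl, dotZr) => dm; rewrite [dot m d]dotC dm => <-; ring.
Qed.

Lemma dual_similar L M : row_free L -> row_free M -> L *m M^T = 0 ->
  similar (plucker Elliptic L) (plucker Elliptic M).
Proof.
move=> freeL freeM LM; have /row_free_plucker nz := freeL.
have [||D [freeD dD mD]] := @exists_plucker (mom L) (dir L).
- by move=> [? ?]; apply: nz.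
- by rewrite dotC direction_moment.
have ort i j : form 1 (row i L) (row j M) = 0 by rewrite -mulmx_tr_form LM mxE.
have subD j : (row j M <= D)%MS.
  have rE i : dot (spatial (row j M)) (spatial (row i L)) =
      - (row i L 0 h3 * row j M 0 h3).
    by apply/eqP; rewrite -addr_eq0 dotC -[X in _ + X]mul1r -formE ort.
  apply: on_line_sub => //; rewrite dD mD; split.
    rewrite /moment cross_cross !rE /direction.
    move: (spatial _) (spatial _) (_ 0 h3) (_ 0 h3) (_ 0 h3) => P Q a b c.
    by apply: row3P; rewrite !mxE; ring.
  by rewrite /direction dotBr !dotZr !rE; ring.
have /eqmx_similar-/(_ Elliptic freeD freeM) DM : (D :=: M)%MS.
  apply/eqmx_sym/eqmxP; have sub : (M <= D)%MS by apply/row_subP.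
  by rewrite sub /= -(geq_leqif (mxrank_leqif_sup sub)) (eqP freeD) (eqP freeM).
apply: similar_trans DM; exists ((0, 1) : gnumber Elliptic R).
  by apply/invertible_pair; rewrite expr0n expr1n sub0r oppr_eq0 mulr1 oner_eq0.
by rewrite /plucker dD mD scale_gvec mulr1 !scale0r !add0r !scale1r.
Qed.

Lemma elliptic_coordinatizes : coordinatizes
  (two_plane_line (@elliptic_point R)) (@same_or_dual R)
  (two_plane_right_angle 1 (@elliptic_point R)) (plucker Elliptic).
Proof.
split.
- move=> L /elliptic_lineP /row_free_plucker nz; rewrite dot_gvec dotC.
  rewrite [dot (moment _ _) (direction _ _)]dotC direction_moment addr0.
  apply/invertible_pair; rewrite expr0n mulr0 subr0 sqrf_eq0 mul1r.
  rewrite paddr_eq0 ?dot_ge0 // !dot_eq0; apply/negP => /andP[/eqP d0 /eqP m0].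
  exact: nz.
- move=> L M /elliptic_lineP freeL /elliptic_lineP freeM; rewrite dot_plucker_eq0.
  split; first by apply: right_angle_equations; rewrite // mulr1.
  move=> [LM /(common_vector freeL freeM)[p [p0 pL pM]]].
  apply: (right_angle_at (p := p)) => //; first by rewrite mulr1.
  rewrite formE mul1r; apply: contra p0.
  rewrite -expr2 paddr_eq0 ?dot_ge0 ?sqr_ge0 //.
  rewrite dot_eq0 sqrf_eq0 => /andP[/eqP sp /eqP p3]; apply/eqP.
  have z k := congr1 (fun w : 'rV[R]_3 => w 0 k) sp.
  move: (z o0) (z o1) (z o2); rewrite /spatial !mxE /= => z0 z1 z2.
  by apply: row4P; rewrite [RHS]mxE.
- move=> L M /elliptic_lineP freeL /elliptic_lineP freeM; split.
    case=> [|LM]; first exact: eqmx_similar.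
    exact: dual_similar.
  case=> -[a b] ci; rewrite scale_gvec mul1r => /gvec_inj[dM mM].
  have /row_free_plucker nz := freeL.
  have q0 : dot (dir L) (dir L) + dot (mom L) (mom L) != 0.
    rewrite paddr_eq0 ?dot_ge0 // !dot_eq0; apply/negP => /andP[/eqP ? /eqP ?].
    exact: nz.
  have := direction_moment (row 0 M) (row 1 M); rewrite dM mM -{1}[b]mul1r.
  move=> /(orthogonal_multiple (direction_moment _ _)) /eqP; rewrite mul1r.
  rewrite !mulf_eq0 (negbTE q0) orbF => /orP[] /eqP z0; rewrite z0 in ci dM mM *.
    right; have b0 : b != 0.
      move/invertible_pair: ci; rewrite expr0n sub0r oppr_eq0 mul1r sqrf_eq0; exact.
    rewrite !scale0r ?add0r ?addr0 in dM mM.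
    apply/matrixP => i j; rewrite mulmx_tr_form mxE.
    apply: (on_line_dual nz); first exact/sub_on_line/row_sub.
    by apply/(on_lineZ _ _ _ b0); rewrite -dM -mM; apply/sub_on_line/row_sub.
  left; have a0 : a != 0.
    move/invertible_pair: ci; rewrite expr0n mulr0 subr0 sqrf_eq0; exact.
  rewrite !scale0r !addr0 in dM mM.
  by apply/eqmx_plucker => //; exists a.
- move=> n /orthogonal_representative[d [m [nE dm q0]]].
  have [|L [freeL dL mL]] := exists_plucker _ dm.
    by move=> [d0 m0]; move: q0; rewrite d0 m0 !dot0l mulr0 addr0 eqxx.
  by exists L; [apply/elliptic_lineP|rewrite /plucker dL mL].
- move=> u u0; have [||L [freeL dL mL]] := @exists_plucker u 0.
  + by move=> [/eqP]; rewrite (negbTE u0).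
  + by rewrite dotC dot0l.
  by exists L; [apply/elliptic_lineP|rewrite /plucker dL mL gvec_real].
Qed.
End Construction.

(** * Lines in hyperbolic space *)

Section HyperbolicLines.
Variable R : realType.
Implicit Types (p q r u v : 'rV[R]_4) (d m : 'rV[R]_3) (L M : 'M[R]_(2, 4)).

Notation dir L := (direction (row 0 L) (row 1 L)).
Notation mom L := (moment (row 0 L) (row 1 L)).
Notation hyperbolic_line := (two_plane_line (@hyperbolic_point R)).

Lemma cauchy_schwarz d m : dot d m ^+ 2 <= dot d d * dot m m.
Proof. by rewrite lagrange lerDl dot_ge0. Qed.

(** If [p] is on the line, then [p_3 m] is the cross product of the spatial part
    of [p] with [d], and the spatial part is shorter than [p_3]. *)
Lemma hyperbolic_line_gt0 L : hyperbolic_line L ->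
  0 < dot (dir L) (dir L) - dot (mom L) (mom L).
Proof.
case=> free [p]; rewrite /hyperbolic_point formE mulN1r subr_lt0 -expr2 => pneg.
have /row_free_plucker nz := free.
move=> /sub_on_line[pm _].
have p3 : p 0 h3 != 0.
  by apply: contraTneq pneg => ->; rewrite expr0n -leNgt dot_ge0.
have d0 : dir L != 0.
  apply/eqP => d0; apply: nz; split => //.
  by apply: (scalerI p3); rewrite pm d0 cross0r scaler0.
have := lagrange (spatial p) (dir L); rewrite -pm dotZl dotZr.
have dd : 0 < dot (dir L) (dir L) by rewrite lt_def dot_eq0 d0 dot_ge0.
move=> E; rewrite subr_gt0 -(ltr_pM2l (_ : 0 < p 0 h3 ^+ 2)); last first.
  by rewrite lt_def sqr_ge0 sqrf_eq0 p3.
apply: le_lt_trans (_ : dot (spatial p) (spatial p) * dot (dir L) (dir L) < _).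
  by rewrite E mulrA -expr2 lerDr sqr_ge0.
by rewrite ltr_pM2r.
Qed.

Lemma timelike_not_orthogonal u v :
  form (-1) u u < 0 -> form (-1) v v < 0 -> form (-1) u v != 0.
Proof.
rewrite !formE !mulN1r !subr_lt0 -!expr2 => uu vv; apply/eqP => /eqP.
rewrite subr_eq0 => /eqP uv.
have := cauchy_schwarz (spatial u) (spatial v).
rewrite uv exprMn leNgt => /negP; apply.
by rewrite ltr_pM ?dot_ge0.
Qed.

(** Orthogonal lines meet inside of the hyperbolic space. At an isotropic common
    vector one of the two 2-planes would be degenerate; at a spacelike one the
    orthogonal directions would be timelike, and orthogonal to each other. *)
Lemma hyperbolic_meet L M p : hyperbolic_line L -> hyperbolic_line M ->
  p != 0 -> (p <= L)%MS -> (p <= M)%MS ->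
  dot (dir L) (dir M) - dot (mom L) (mom M) = 0 ->
  form (-1) p p < 0.
Proof.
move=> lL lM p0 pL pM LM.
have gramL L' : hyperbolic_line L' -> (p <= L')%MS -> exists q c,
    [/\ c != 0, dir L' = c *: direction p q, mom L' = c *: moment p q
      & form (-1) p p * form (-1) q q - form (-1) p q ^+ 2 < 0].
  move=> lL' pL'; have [free' _] := lL'.
  have [q qL' qp] := second_vector p free'.
  have free := row_free_rows2 p0 qp.
  have L'E := eqmx_sym (eqmx_rows2 free' free pL' qL').
  have [c c0] := (eqmx_plucker free free').1 L'E.
  rewrite row0_rows2 row1_rows2 => -[dE mE]; exists q, c; split => //.
  have := hyperbolic_line_gt0 lL'; rewrite dE mE !dotZl !dotZr.
  rewrite expr2 gram mulN1r !mulrA -mulrBr pmulr_rgt0.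
    by rewrite subr_gt0 addrC subr_lt0.
  by rewrite -expr2 lt_def sqr_ge0 sqrf_eq0 c0.
have [q [c [c0 dL mL gq]]] := gramL L lL pL.
have [r [c' [c'0 dM mM gr]]] := gramL M lM pM.
have g : form (-1) p p * form (-1) q r - form (-1) p q * form (-1) p r = 0.
  have := gram (-1) p q r; move: LM; rewrite dL mL dM mM !dotZl !dotZr => E ->.
  apply/eqP; move/eqP: E.
  rewrite !mulrA -mulrBr !mulf_eq0 (negbTE c0) (negbTE c'0) /=.
  by move=> /eqP E0; apply/eqP; rewrite -[RHS]oppr0 -E0; ring.
rewrite ltNge; apply/negP; rewrite le_eqVlt => /orP[/eqP pp|pp].
  rewrite -pp mul0r sub0r in gq; rewrite -pp mul0r sub0r in gr.
  rewrite -pp mul0r sub0r in g; move: g => /eqP; rewrite oppr_eq0 mulf_eq0.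
  move: gq gr; rewrite !oppr_lt0 !lt_def !sqrf_eq0.
  by move=> /andP[/negbTE -> _] /andP[/negbTE -> _].
pose u := form (-1) p p *: q - form (-1) p q *: p.
pose v := form (-1) p p *: r - form (-1) p r *: p.
have uu : form (-1) u u < 0.
  rewrite /u !(formBl, formBr, formZl, formZr) (formC _ q p).
  have : form (-1) p p *
      (form (-1) p p * form (-1) q q - form (-1) p q ^+ 2) < 0.
    by rewrite pmulr_rlt0.
  by lra.
have vv : form (-1) v v < 0.
  rewrite /v !(formBl, formBr, formZl, formZr) (formC _ r p).
  have : form (-1) p p *
      (form (-1) p p * form (-1) r r - form (-1) p r ^+ 2) < 0.
    by rewrite pmulr_rlt0.
  by lra.
have /eqP := timelike_not_orthogonal uu vv; apply.
rewrite /u /v !(formBl, formBr, formZl, formZr) (formC _ q p).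
by rewrite -[RHS](mulr0 (form (-1) p p)) -g; ring.
Qed.

(** The foot has the squared norm [m.m / d.d], less than one. *)
Lemma exists_hyperbolic_line d m : dot d m = 0 -> dot m m < dot d d ->
  exists2 L, hyperbolic_line L & dir L = d /\ mom L = m.
Proof.
move=> dm md; have dd := le_lt_trans (dot_ge0 m) md.
have d0 : d != 0 by rewrite -dot_eq0 gt_eqF.
have [L [free dE mE pL]] := exists_affine_plucker d0 dm.
exists L => //; split => //; exists (affine (foot d m) 1) => //.
rewrite /hyperbolic_point formE spatial_affine affine3 dot_foot // mulr1 mulN1r.
by rewrite subr_lt0 ltr_pdivrMr // mul1r.
Qed.

Lemma hyperbolic_coordinatizes : coordinatizes
  hyperbolic_line (@same_two_plane R)
  (two_plane_right_angle (-1) (@hyperbolic_point R)) (plucker Hyperbolic).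
Proof.
have e2 : -1 * -1 = 1 :> R by rewrite mulrNN mulr1.
split.
- move=> L /hyperbolic_line_gt0 q0; rewrite dot_gvec dotC.
  rewrite [dot (moment _ _) (direction _ _)]dotC direction_moment addr0.
  apply/invertible_pair; rewrite expr0n mulr0 subr0 sqrf_eq0 mulN1r.
  by rewrite gt_eqF.
- move=> L M lL lM; have [freeL _] := lL; have [freeM _] := lM.
  rewrite dot_plucker_eq0; split; first exact: right_angle_equations.
  move=> [LM /(common_vector freeL freeM)[p [p0 pL pM]]].
  have pneg : form (-1) p p < 0.
    by apply: (hyperbolic_meet lL lM p0 pL pM); rewrite -[X in _ + X]mulN1r.
  by apply: (right_angle_at (p := p)) => //; rewrite lt_eqF.
- move=> L M lL lM; have [freeL _] := lL; have [freeM _] := lM.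
  split; first exact: eqmx_similar.
  case=> -[a b] ci; rewrite scale_gvec => /gvec_inj[dM mM].
  have qL := hyperbolic_line_gt0 lL; have qM := hyperbolic_line_gt0 lM.
  have := direction_moment (row 0 M) (row 1 M); rewrite dM mM.
  move=> /(orthogonal_multiple (direction_moment _ _)) /eqP.
  rewrite (mulN1r (dot _ _)) !mulf_eq0 (gt_eqF qL) orbF.
  move=> /orP[] /eqP z0; rewrite z0 in ci dM mM *.
    move: qM; rewrite dM mM !scale0r add0r add0r !mulN1r !(dotZl, dotZr).
    have := mulr_ge0 (sqr_ge0 b) (ltW qL); lra.
  have a0 : a != 0.
    move/invertible_pair: ci; rewrite expr0n mulr0 subr0 sqrf_eq0; exact.
  rewrite mulr0 !scale0r !addr0 in dM mM.
  by apply/eqmx_plucker => //; exists a.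
- move=> n /orthogonal_representative[d [m [nE dm]]].
  rewrite mulN1r subr_eq0 neq_lt => /orP[dltm|mltd].
    (* Multiplication by j changes the sign of z.z. *)
    have [||L lL [dL mL]] := @exists_hyperbolic_line (- m) d.
    + by rewrite -scaleN1r dotZl dotC dm mulr0.
    + by rewrite -scaleN1r dotZl dotZr mulrA e2 mul1r.
    exists L => //; rewrite /plucker dL mL; apply: similar_trans nE _.
    exists ((0, 1) : gnumber Hyperbolic R).
      apply/invertible_pair; rewrite expr0n expr1n sub0r oppr_eq0 mulr1.
      by rewrite oppr_eq0 oner_eq0.
    by rewrite scale_gvec !scale0r !add0r mulr1 scale1r scaleN1r.
  have [L lL [dL mL]] := exists_hyperbolic_line dm mltd.
  by exists L => //; rewrite /plucker dL mL.
- move=> u u0; have [||L lL [dL mL]] := @exists_hyperbolic_line u 0.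
  + by rewrite dotC dot0l.
  + by rewrite dot0l lt_def dot_eq0 u0 dot_ge0.
  by exists L => //; rewrite /plucker dL mL gvec_real.
Qed.
End HyperbolicLines.

(** * Lines in Euclidean space *)

Definition euclidean_plucker (K : comNzRingType) (L : 'M[K]_(2, 3)) :
    'rV[gnumber Euclidean K]_3 :=
  gvec Euclidean (row 1 L) (cross (row 0 L) (row 1 L)).

Lemma map_euclidean_plucker (K S : comNzRingType) (f : {rmorphism K -> S})
    (L : 'M[K]_(2, 3)) :
  euclidean_plucker (map_mx f L) = map_mx (gmap f) (euclidean_plucker L).
Proof.
apply/rowP; apply: ord3P; rewrite /euclidean_plucker !mxE /gmap /=;
  by rewrite !rmorphB !rmorphM.
Qed.

Section EuclideanLines.
Variable R : realType.
Implicit Types (p u d m : 'rV[R]_3) (L M : 'M[R]_(2, 3)).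

Notation euclidean_line := (fun L : 'M[R]_(2, 3) => row 1 L != 0).
Notation mom L := (cross (row 0 L) (row 1 L)).

Lemma crossBl p u d : cross (p - u) d = cross p d - cross u d.
Proof. by apply: row3P; rewrite /cross !mxE /=; ring. Qed.
Lemma crossDl p u d : cross (p + u) d = cross p d + cross u d.
Proof. by apply: row3P; rewrite /cross !mxE /=; ring. Qed.
Lemma crossC u d : cross u d = - cross d u.
Proof. by apply: row3P; rewrite /cross !mxE /=; ring. Qed.

Lemma on_euclidean_lineP L p : row 1 L != 0 ->
  on_euclidean_line L p <-> cross p (row 1 L) = mom L.
Proof.
move=> d0; split => [[t ->]|pE].
  by rewrite crossDl crossZl crossvv scaler0 addr0.
have [|t tE] := @cross_eq0 _ (row 1 L) (p - row 0 L) d0.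
  by rewrite crossC crossBl pE subrr oppr0.
by exists t; rewrite -tE addrC subrK.
Qed.

Lemma dot_euclidean_plucker L M :
  dot (euclidean_plucker L) (euclidean_plucker M) =
  (dot (row 1 L) (row 1 M), dot (row 1 L) (mom M) + dot (mom L) (row 1 M)).
Proof. by rewrite dot_gvec mul0r addr0. Qed.

(** Two orthogonal lines are coplanar when the vector [w] from one to the other
    has no component along the common perpendicular [d x d']; then [w] is a
    combination of [d] and [d'], whose coefficients locate the common point. *)
Lemma euclidean_right_angleP L M : row 1 L != 0 -> row 1 M != 0 ->
  euclidean_right_angle L M <->
  dot (row 1 L) (row 1 M) = 0 /\ dot (row 1 L) (mom M) + dot (mom L) (row 1 M) = 0.
Proof.
rewrite /euclidean_right_angle => d0 d'0; split.
  case=> -[p [/(on_euclidean_lineP _ d0) <- /(on_euclidean_lineP _ d'0) <-]].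
  by move=> /dot_mulmx_tr dd; split => //; rewrite /dot /cross !mxE /=; ring.
set d := row 1 L in d0 *; set d' := row 1 M in d'0 *.
move=> [dd' LM]; split; last exact/dot_mulmx_tr.
have [w wE] : exists w, w = row 0 M - row 0 L by eexists.
pose s := dot w d / dot d d; pose t := dot w d' / dot d' d'.
pose x := w - s *: d - t *: d'.
have dn : dot d d != 0 by rewrite dot_eq0.
have d'n : dot d' d' != 0 by rewrite dot_eq0.
have xd : dot x d = 0.
  rewrite /x !dotBl !dotZl [dot d' d]dotC dd' mulr0 subr0.
  by rewrite /s divfK // subrr.
have xd' : dot x d' = 0.
  rewrite /x !dotBl !dotZl dd' mulr0 subr0.
  by rewrite /t divfK // subrr.
have x0 : x = 0.
  have n0 := cross_orthogonal_neq0 d0 d'0 dd'.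
  have := orthogonal_cross xd xd'; suff -> : dot x (cross d d') = 0.
    by rewrite scale0r => /eqP; rewrite scaler_eq0 dot_eq0 (negbTE n0) => /eqP.
  rewrite /x !dotBl !dotZl dot_crossl dot_crossr !mulr0 !subr0 -[RHS]oppr0 -LM wE.
  by rewrite /dot /cross ?mxE /=; ring.
exists (row 0 L + s *: d); split; first by exists s.
exists (- t); rewrite -[LHS]add0r -x0 /x wE.
move: (s) (t); rewrite /d /d' => a b.
move: (row 0 L) (row 0 M) (row 1 L) (row 1 M) => P Q u v.
by apply/rowP => k; rewrite !mxE; ring.
Qed.

Lemma exists_rows p d : exists2 L : 'M[R]_(2, 3), row 0 L = p & row 1 L = d.
Proof.
exists (\matrix_(i, k) if i == 0 then p 0 k else d 0 k);
  by apply/rowP => k; rewrite !mxE.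
Qed.

Lemma euclidean_coordinatizes : coordinatizes euclidean_line
  (fun L M => forall p, on_euclidean_line L p <-> on_euclidean_line M p)
  (@euclidean_right_angle R) (@euclidean_plucker R).
Proof.
split.
- move=> L d0; rewrite dot_euclidean_plucker.
  by apply/invertible_pair; rewrite mul0r subr0 sqrf_eq0 dot_eq0.
- move=> L M d0 d'0; rewrite dot_euclidean_plucker euclidean_right_angleP //.
  by split => [[-> ->]|[]].
- move=> L M d0 d'0; split => [same|[[a b] ci]].
    have on0 : on_euclidean_line L (row 0 L).
      by exists 0; rewrite scale0r addr0.
    have on1 : on_euclidean_line L (row 0 L + row 1 L).
      by exists 1; rewrite scale1r.
    have /(on_euclidean_lineP _ d'0) m0 := (same _).1 on0.
    have /(on_euclidean_lineP _ d'0) := (same _).1 on1; rewrite crossDl m0.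
    rewrite -[RHS]addr0 => /addrI /(cross_eq0 d0)[c dE].
    have c0 : c != 0 by apply: contra_neq d'0 => c0; rewrite dE c0 scale0r.
    rewrite /euclidean_plucker -m0 dE crossZr.
    exact: similar_gvec_real.
  rewrite scale_gvec mul0r scale0r addr0 => /gvec_inj[dE mE].
  have a0 : a != 0 by move/invertible_pair: ci; rewrite mul0r subr0 sqrf_eq0.
  have b0 : b = 0.
    have := dot_crossr (row 0 M) (row 1 M); rewrite mE dE dotZl dotDr !dotZr.
    rewrite dot_crossr mulr0 add0r => /eqP.
    by rewrite !mulf_eq0 (negbTE a0) dot_eq0 (negbTE d0) orbF => /eqP.
  rewrite b0 scale0r addr0 in mE => p.
  rewrite !on_euclidean_lineP // mE dE crossZr.
  by split=> [->|/(scalerI a0)].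
- move=> n /orthogonal_representative[d [m [nE dm]]].
  rewrite mul0r addr0 dot_eq0 => d0.
  have [L L0 L1] := exists_rows (foot d m) d.
  by exists L; rewrite ?L1 // /euclidean_plucker L0 L1 cross_foot.
- move=> u u0; have [L L0 L1] := exists_rows 0 u.
  by exists L; rewrite ?L1 // /euclidean_plucker L0 L1 cross0l gvec_real.
Qed.
End EuclideanLines.

(** * Configurations of lines in space *)

Lemma invertible_real_square g (R : realType) (u : 'rV[R]_3) :
  u != 0 -> invertible (greal g (dot u u)).
Proof.
move=> u0; apply/invertible_gnumber.
by rewrite /gnorm /= expr0n mulr0 subr0 sqrf_eq0 dot_eq0.
Qed.

Lemma labels_in_range (K : comNzRingType) s (P L : seq 'rV[K]_3) concl c :
  labels_ok s (size P) (size L) concl -> c \in concl ->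
  (c.1 < size (construct s P L).1)%N /\ (c.2 < size (construct s P L).2)%N.
Proof.
elim: s P L => [|[i j|i j|i|j] s IHs] P L /=.
- by move=> /allP ok /ok /andP.
- by case/and3P => _ _ ok; apply: IHs; rewrite size_rcons.
- by case/and3P => _ _ ok; apply: IHs; rewrite size_rcons.
- by case/andP => _ ok; apply: IHs; rewrite size_rcons.
- by case/andP => _ ok; apply: IHs; rewrite size_rcons.
Qed.

Section Simulation.
Variables (R : realType) (g : geometry) (r c : nat).
Variables (line : 'M[R]_(r, c) -> Prop)
  (same right_angle : 'M[R]_(r, c) -> 'M[R]_(r, c) -> Prop).
Variable psi : forall K : comNzRingType, 'M[K]_(r, c) -> 'rV[gnumber g K]_3.
Hypothesis map_psi : forall (K S : comNzRingType) (f : {rmorphism K -> S})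
    (L : 'M[K]_(r, c)),
  psi (map_mx f L) = map_mx (gmap f) (psi L).
Hypothesis coordP : coordinatizes line same right_angle (@psi R).
Notation W := (line_world line same right_angle).
Notation A := (gnumber g R).

Definition represent (Z : seq 'M[R]_(r, c)) (z : seq 'rV[A]_3) : Prop :=
  size Z = size z /\
  forall i, (i < size Z)%N -> line Z`_i /\ similar z`_i (psi Z`_i).

Lemma represent_rcons Z z M m : represent Z z -> line M -> similar m (psi M) ->
  represent (rcons Z M) (rcons z m).
Proof.
move=> [szZ repZ] lM mM; split; first by rewrite !size_rcons szZ.
move=> i; rewrite size_rcons ltnS leq_eqVlt !nth_rcons -szZ.
by case/predU1P => [->|ltiZ]; rewrite ?ltnn ?eqxx ?ltiZ //; apply: repZ.
Qed.

(** Over the algebra, orthogonality to two vectors determines a vector up to a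
    unit ([similar_cross]); through [coordinatizes] this becomes the existence
    and the uniqueness of the skewer of two lines. *)
Lemma skewer (M M' : 'M[R]_(r, c)) (m m' : 'rV[A]_3) :
  line M -> line M' -> similar m (psi M) -> similar m' (psi M') ->
  invertible (dot (cross m m') (cross m m')) ->
  let skew :=
    [set S | [/\ line S, dot (psi M) (psi S) = 0 & dot (psi M') (psi S) = 0]] in
  [/\ skew !=set0, (forall S S', skew S -> skew S' -> same S S') &
      forall S, skew S -> similar (cross m m') (psi S)].
Proof.
case: coordP => G1 _ G3 G4 _ lM lM' mM m'M' ni skew.
have uniq S : skew S -> similar (cross m m') (psi S).
  move=> [lS MS M'S]; apply: (similar_cross (G1 _ lS) ni); rewrite dotC.
    exact: (dot_similar mM (similar_refl (psi S))).2 MS.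
  exact: (dot_similar m'M' (similar_refl (psi S))).2 M'S.
split; last exact: uniq.
  have [S lS nS] := G4 _ ni; exists S; split; first exact: lS.
    exact: (dot_similar mM nS).1 (dot_crossl _ _).
  exact: (dot_similar m'M' nS).1 (dot_crossr _ _).
move=> S S' sS sS'; have [lS _ _] := sS; have [lS' _ _] := sS'.
apply: (G3 _ _ lS lS').2.
exact: similar_trans (similar_sym (uniq _ sS)) (uniq _ sS').
Qed.

(** By [skewer], the coordinates which are chosen for a new line represent the
    cross product, whatever the choice; thus [construct] follows all of them. *)
Lemma space_construct s (K : seq 'M[R]_(r, c) -> seq 'M[R]_(r, c) -> Prop)
    concl P L (p l : seq 'rV[A]_3) :
  labels_ok s (size P) (size L) concl -> represent P p -> represent L l ->
  (forall u, u \in (construct s p l).1 ++ (construct s p l).2 ->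
     invertible (dot u u)) ->
  (forall P' L', represent P' (construct s p l).1 ->
     represent L' (construct s p l).2 -> K P' L') ->
  after (W := W) s K P L.
Proof.
case: coordP => G1 G2 G3 G4 _.
have polar M m (copies := [set S | line S /\ same M S]) :
  line M -> similar m (psi M) ->
  [/\ copies !=set0, (forall S S', copies S -> copies S' -> same S S')
    & forall S, copies S -> similar m (psi S)].
  move=> lM mM; split.
  - by exists M; split => //; apply/G3 => //; apply: similar_refl.
  - move=> S S' [lS MS] [lS' MS']; apply/G3 => //.
    apply: (@similar_trans _ (psi M)); last exact/G3.
    by apply/similar_sym/G3.
  - by move=> S [lS MS]; apply: similar_trans mM _; apply/G3.
elim: s P L p l => [|[i j|i j|i|j] s IHs] P L p l /=.
- by move=> _ repP repL _; apply.
- case/and3P => ltiP ltjP lab repP repL inv KP.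
  have [lPi simi] := repP.2 _ ltiP; have [lPj simj] := repP.2 _ ltjP.
  have ni : invertible (dot (cross p`_i p`_j) (cross p`_i p`_j)).
    apply: inv; rewrite mem_cat; apply/orP; right.
    by apply: (construct_sub _ _ _).2; rewrite mem_rcons mem_head.
  have [/= ex uni val] := skewer lPi lPj simi simj ni.
  have skewE S : connecting (W := W) P`_i P`_j S <->
      [/\ line S, dot (psi P`_i) (psi S) = 0 & dot (psi P`_j) (psi S) = 0].
    split=> -[lS /= e1 e2]; split=> //.
    + exact: (G2 _ _ lPi lS).1 e1.
    + exact: (G2 _ _ lPj lS).1 e2.
    + exact: (G2 _ _ lPi lS).2 e1.
    + exact: (G2 _ _ lPj lS).2 e2.
  split.
  + by have [S /skewE sS] := ex; exists S.
  + by move=> S S' /skewE sS /skewE sS'; exact: (uni _ _ sS sS').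
  + move=> S /skewE sS; have [lS _ _] := sS.
    apply: (IHs _ _ p (rcons l (cross p`_i p`_j))); rewrite ?size_rcons //.
    exact: (represent_rcons repL lS (val _ sS)).
- case/and3P => ltiL ltjL lab repP repL inv KP.
  have [lLi simi] := repL.2 _ ltiL; have [lLj simj] := repL.2 _ ltjL.
  have ni : invertible (dot (cross l`_i l`_j) (cross l`_i l`_j)).
    apply: inv; rewrite mem_cat; apply/orP; left.
    by apply: (construct_sub _ _ _).1; rewrite mem_rcons mem_head.
  have [/= ex uni val] := skewer lLi lLj simi simj ni.
  have skewE S : intersecting (W := W) L`_i L`_j S <->
      [/\ line S, dot (psi L`_i) (psi S) = 0 & dot (psi L`_j) (psi S) = 0].
    rewrite ![dot _ (psi S)]dotC; split=> -[lS /= e1 e2]; split=> //.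
    + exact: (G2 _ _ lS lLi).1 e1.
    + exact: (G2 _ _ lS lLj).1 e2.
    + exact: (G2 _ _ lS lLi).2 e1.
    + exact: (G2 _ _ lS lLj).2 e2.
  split.
  + by have [S /skewE sS] := ex; exists S.
  + by move=> S S' /skewE sS /skewE sS'; exact: (uni _ _ sS sS').
  + move=> S /skewE sS; have [lS _ _] := sS.
    apply: (IHs _ _ (rcons p (cross l`_i l`_j)) l); rewrite ?size_rcons //.
    exact: (represent_rcons repP lS (val _ sS)).
- case/andP => ltiP lab repP repL inv KP.
  have [lPi simi] := repP.2 _ ltiP; have [ex uni val] := polar _ _ lPi simi.
  split => // S sS; have [lS _] := sS.
  apply: (IHs _ _ p (rcons l p`_i)) => //; first by rewrite size_rcons.
  by apply: represent_rcons => //; apply: val.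
- case/andP => ltjL lab repP repL inv KP.
  have [lLj simj] := repL.2 _ ltjL.
  have pE : polar_point_of (W := W) L`_j = [set S | line S /\ same L`_j S].
    apply/seteqP; split => S /= [lS sS]; split => //; apply/G3 => //;
    by apply/similar_sym/G3.
  have [ex uni val] := polar _ _ lLj simj.
  rewrite /for_the pE; split => // S sS; have [lS _] := sS.
  apply: (IHs _ _ (rcons p l`_j) l) => //; first by rewrite size_rcons.
  by apply: represent_rcons => //; apply: val.
Qed.

Variable T : configuration.
Hypothesis wl : well_labelled T.

Lemma represent_map m (f : 'I_m -> 'M[R]_(r, c)) : (forall i, line (f i)) ->
  represent [seq f i | i <- enum 'I_m] [seq psi (f i) | i <- enum 'I_m].
Proof.
move=> lf; split; first by rewrite !size_map.
move=> i; rewrite size_map => lti.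
have ltim : (i < m)%N by move: lti; rewrite size_enum_ord.
rewrite (nth_map (Ordinal ltim) 0 f) ?size_enum_ord //.
rewrite (nth_map (Ordinal ltim) 0 (fun k => psi (f k))) ?size_enum_ord //.
 by split => //; exact: similar_refl.
Qed.

Lemma initial_conditions_space (x : object T -> 'M[R]_(r, c)) :
  initial_conditions (W := W) x <->
  (forall o, line (x o)) /\
  (forall e, e \in init_incident T ->
     dot (psi (x (inl e.1))) (psi (x (inr e.2))) = 0) /\
  (forall e, e \in init_polar T ->
     similar (psi (x (inl e.1))) (psi (x (inr e.2)))).
Proof.
case: coordP => _ G2 G3 _ _; split.
  move=> [lP lL inc pol]; split; first by case.
  split => e eT; first exact: (G2 _ _ (lP _) (lL _)).1 (inc e eT).
  exact: (G3 _ _ (lP _) (lL _)).1 (pol e eT).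
move=> [lx [inc pol]]; split=> [i|j|e /inc|e /pol]; [exact: lx|exact: lx| |].
  by move=> ?; apply/G2.
by move=> ?; apply/G3.
Qed.

Lemma conclusion_space (x : object T -> 'M[R]_(r, c)) (z := fun o => psi (x o)) :
  (forall o, line (x o)) ->
  (forall e, e \in final_equations z -> e = 0) -> invertible (discriminant z) ->
  conclusion_holds (W := W) x.
Proof.
move=> lx zf Dz; case: coordP => G1 G2 G3 G4 _.
have [inc pol] := (final_equationsP z).1 zf.
have lab0 : labels_ok (instructions T)
    (size [seq x (inl i) | i <- enum 'I_(npoints T)])
    (size [seq x (inr j) | j <- enum 'I_(nlines T)])
    (concl_incident T ++ concl_polar T).
  by rewrite !size_enum_map; exact: wl.
apply: (space_construct lab0 (p := [seq z (inl i) | i <- enum 'I_(npoints T)])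
   (l := [seq z (inr j) | j <- enum 'I_(nlines T)])).
- exact: represent_map.
- exact: represent_map.
- by move=> u uz; apply: (discriminant_invertible Dz).
rewrite -[construct _ _ _]/(constructed z) => P' L' repP repL.
have range e : e \in concl_incident T ++ concl_polar T ->
    (e.1 < size (constructed z).1)%N /\ (e.2 < size (constructed z).2)%N.
  by apply: labels_in_range; rewrite !size_enum_map; exact: wl.
have at_e e : e \in concl_incident T ++ concl_polar T ->
    [/\ line P'`_(e.1), line L'`_(e.2),
        similar (constructed z).1`_(e.1) (psi P'`_(e.1))
      & similar (constructed z).2`_(e.2) (psi L'`_(e.2))].
  move=> /range[lt1 lt2]; rewrite -repP.1 in lt1; rewrite -repL.1 in lt2.
  have [lP sP] := repP.2 _ lt1; have [lL sL] := repL.2 _ lt2.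
  exact: And4 lP lL sP sL.
split=> e eT /=.
  have eT' : e \in concl_incident T ++ concl_polar T by rewrite mem_cat eT.
  have [lP lL sP sL] := at_e e eT'.
  by apply/G2 => //; apply/(dot_similar sP sL)/inc.
have eT' : e \in concl_incident T ++ concl_polar T by rewrite mem_cat eT orbT.
have [lP lL sP sL] := at_e e eT'; have [lt1 lt2] := range e eT'.
apply/G3 => //; apply: similar_trans sL; apply: similar_trans (similar_sym sP) _.
apply: similar_of_cross0; last exact: pol.
  by apply: (discriminant_invertible Dz); rewrite mem_cat mem_nth.
by apply: (discriminant_invertible Dz); rewrite mem_cat mem_nth ?orbT.
Qed.

(** The open set is given by the norm of [h] at the coordinates [psi] of the
    lines, a polynomial in the entries of the matrices of the lines. It contains
    the lines whose coordinates are the real vectors [x0]. *)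
Lemma holds_generically_in_space (x0 : object T -> 'rV[R]_3) h :
  initial_conditions (W := plane (1%:M : 'M[R]_3)) x0 -> transfers g x0 h ->
  holds_generically (W := W) (T := T) setT.
Proof.
case: (coordP) => _ _ _ _ G5 /initial_conditions_plane[x0nz x0e] [hx0 hP].
pose Y := @generic_point R W T.
pose N' := #|coordinate W T|.
pose incl : {rmorphism R -> gnumber g (mpoly N' R)} :=
  @greal g (mpoly N' R) \o @mpolyC N' R.
pose PW := plane (1%:M : 'M[R]_3).
pose H : gnumber g (mpoly N' R) :=
  mmap incl (@coordinates R PW T _ (fun o => psi (Y o))) h.
pose q : mpoly N' R := gnorm H.
have qE (x : object T -> 'M[R]_(r, c)) :
    meval (@coordinates R W T _ x) q = gnorm (geval (fun o => psi (x o)) h).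
  pose ev : {rmorphism mpoly N' R -> R} := meval (@coordinates R W T _ x).
  rewrite -[LHS]/(ev (gnorm H)) -gnorm_gmap /H mmap_morph; congr gnorm.
  apply: mmap_eq => [a|k] /=.
    by rewrite /gmap /greal /= mevalC rmorph0.
  have := map_psi ev (Y (enum_val k).1).
  have -> : map_mx ev (Y (enum_val k).1) = x (enum_val k).1.
    have evY : (fun o => map_mx ev (Y o)) = x.
      exact: (@map_generic_point R W T _ idfun).
    exact: (congr1 (fun f : object T -> 'M[R]_(r, c) => f (enum_val k).1) evY).
  by move=> E; rewrite /coordinates E mxE.
pose U := [set x : object T -> 'M[R]_(r, c) |
  meval (@coordinates R W T _ x) q != 0].
exists U; split.
- exists [set q]; apply/seteqP; split => x /=; first by exists q.
  by case=> _ ->.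
- have /choice[x xP] o : exists L, line L /\ psi L = map_mx (@greal g R) (x0 o).
    by have [L ? ?] := G5 _ (x0nz o); exists L.
  have [inc pol] := (initial_equationsP x0).1 x0e.
  exists x; split => //.
    apply/initial_conditions_space; split => [k|]; first by case: (xP k).
    have psix k : psi (x k) = map_mx (@greal g R) (x0 k) by case: (xP k).
    split => e eT; rewrite !psix; first by rewrite map_dot inc // rmorph0.
    apply: similar_of_cross0; rewrite ?map_dot ?map_cross ?pol ?map_mx0 //.
      exact: invertible_real_square.
    exact: invertible_real_square.
  rewrite /U /= qE.
  have -> : (fun o => psi (x o)) = (fun o => map_mx (@greal g R) (x0 o)).
    by apply/funext => k; case: (xP k).
  by rewrite geval_real /gnorm /= expr0n mulr0 subr0 sqrf_eq0.
move=> x /initial_conditions_space[lx [inc pol]] Ux.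
have ze : forall e, e \in initial_equations (fun o => psi (x o)) -> e = 0.
  apply/initial_equationsP; split => // e /pol [a _ ->].
  by rewrite crossZr crossvv scaler0.
have hz : invertible (geval (fun o => psi (x o)) h).
  by apply/invertible_gnumber; rewrite -qE.
have [zf Dz] := hP _ ze hz.
exact: conclusion_space.
Qed.
End Simulation.

Theorem theorem5 (R : realType) (T : configuration) (g : geometry) :
  well_labelled T ->
  plane_configuration_theorem
    (fun (phi : 'M[R]_3) (x : object T -> 'rV[R]_3) =>
       g <> Elliptic -> nonsingular phi x) ->
  space_configuration_theorem R g T.
Proof.
move=> wl plane_thm.
have [|U [[S UE] [x0 [x0i Ux0 ns]] UP]] := plane_thm 1%:M.
  by split; [rewrite trmx1|rewrite unitmx1].
have [p Sp px0] : exists2 p, S p & reval x0 p != 0 by move: Ux0; rewrite UE.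
have generic : generically_true x0 p.
  by split => // x xi px; apply: UP => //; rewrite UE; exists p.
have [h hP] : exists h, transfers g x0 h.
  case: g ns {plane_thm} => ns.
  - by eexists; exact: transfers_elliptic generic.
  - exact: transfers_nonsingular generic (ns _).
  - exact: transfers_nonsingular generic (ns _).
case: g {plane_thm ns} h hP => h hP.
- exact: (holds_generically_in_space (@map_plucker Elliptic)
    (elliptic_coordinatizes R) wl x0i hP).
- exact: (holds_generically_in_space (@map_euclidean_plucker)
    (euclidean_coordinatizes R) wl x0i hP).
- exact: (holds_generically_in_space (@map_plucker Hyperbolic)
    (hyperbolic_coordinatizes R) wl x0i hP).
Qed.
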